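(* Let $\mathcal{C}\subset\mathbb{R}^p$ be a closed bounded convex set, let $\ell(\cdot;d):\mathcal{C}\to\mathbb{R}$ be convex and $L$-Lipschitz for every $d$ in the data universe, let $\epsilon,\delta$ be privacy parameters, and let $\eta:\{1,\dots,n^2\}\to\mathbb{R}$ be any learning rate function. Then the noisy stochastic gradient descent algorithm $\mathcal{A}_{\sf Noise-GD}$ (described in the context), run with these inputs on data sets of size $n$, is $(\epsilon,\delta)$-differentially private.
   Context: Setting: $\mathcal{X}$ is a data universe; a data set is $\mathcal{D}=\{d_1,\dots,d_n\}$ with $d_i\in\mathcal{X}$. Lipschitz is with respect to the Euclidean norm. $\Pi_{\mathcal{C}}$ denotes Euclidean projection onto $\mathcal{C}$. Differential privacy: two data sets of size $n$ are neighbors if they differ in one entry. A randomized algorithm $\mathcal{A}$ is $(\epsilon,\delta)$-differentially private if for all neighboring $\mathcal{D},\mathcal{D}'$ and all events $S$ in the output space, $\Pr(\mathcal{A}(\mathcal{D})\in S)\le e^{\epsilon}\Pr(\mathcal{A}(\mathcal{D}')\in S)+\delta$. Algorithm $\mathcal{A}_{\sf Noise-GD}$ (inputs: $\mathcal{D}$, $\ell$ with Lipschitz constant $L$, $\epsilon,\delta$, $\mathcal{C}$, $\eta$): 1. Set $\sigma^2=\frac{32L^2n^2\log(n/\delta)\log(1/\delta)}{\epsilon^2}$. 2. Choose any point $\tilde\theta_1\in\mathcal{C}$ (independently of the data). 3. For $t=1,\dots,n^2-1$: pick $d$ uniformly at random from the $n$ entries of $\mathcal{D}$ (with replacement across steps),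 draw $b_t\sim\mathcal{N}(0,\mathbb{I}_p\sigma^2)$ independently, and set $\tilde\theta_{t+1}=\Pi_{\mathcal{C}}\left(\tilde\theta_t-\eta(t)\left[n\nabla\ell(\tilde\theta_t;d)+b_t\right]\right)$. Here $\nabla\ell(\tilde\theta_t;d)$ is the gradient of $\ell(\cdot;d)$ at $\tilde\theta_t$ (or, if $\ell$ is not differentiable, any subgradient). 4. Output $\theta^{priv}=\tilde\theta_{n^2}$.
   Formalization: Privacy parameters are restricted to ε > 0, 0 < δ < 1, ε ≤ 2 log(1/δ) (false for large ε at fixed δ); at non-interior points of C the chosen subgradient must have norm at most L (longer ones break privacy); the gradient choice is assumed Borel measurable. *)

(* Defs.v *)
From HB Require Import structures.
From mathcomp Require Import all_boot all_order all_algebra.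
From mathcomp Require Import all_classical all_reals all_analysis.

Set Implicit Arguments.
Unset Strict Implicit.
Unset Printing Implicit Defensive.

Import Order.TTheory GRing.Theory Num.Theory.
Import numFieldNormedType.Exports.

Local Open Scope classical_set_scope.
Local Open Scope ring_scope.

Section Euclidean.
Context {R : realType} {p : nat}.
Implicit Types (u v x g : 'rV[R]_p) (C : set 'rV[R]_p) (f : 'rV[R]_p -> R).

Definition dotp u v : R := \sum_(i < p) u 0 i * v 0 i.

(* The library norm on 'rV[R]_p is the sup norm. *)
Definition l2norm u : R := Num.sqrt (dotp u u).

Definition l2_lipschitz_on C (L : R) f :=
  forall x y, C x -> C y -> `|f x - f y| <= L * l2norm (x - y).

Definition l2proj C x : 'rV[R]_p :=
  get [set y | C y /\ forall z, C z -> l2norm (x - y) <= l2norm (x - z)].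

Definition is_subgradient C f x g :=
  forall y, C y -> f x + dotp g (y - x) <= f y.

(* [f] is only meaningful on [C], so differentiability is only considered at
   interior points; at every other point [g] is a subgradient relative to [C].
   Relative subgradients at non-interior points can be arbitrarily long (the
   normal cone can be added to them); the bound by [L] selects those that are
   subgradients of an [L]-Lipschitz convex extension of [f] to the whole
   space. At interior points the bound is a consequence. *)
Definition is_gradient_choice C (L : R) f x g :=
  [/\ C^° x -> differentiable f x -> forall v, 'd f x v = dotp g v,
      ~ (C^° x /\ differentiable f x) -> is_subgradient C f x g
    & ~ C^° x -> l2norm g <= L].

End Euclidean.

HB.instance Definition _ (R : realType) (m n : nat) :=
  Measurable.copy 'M[R]_(m, n) (g_sigma_algebraType (@open 'M[R]_(m, n))).

HB.instance Definition _ (n : nat) := isPointed.Build 'I_n.+1 ord0.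
HB.instance Definition _ (n : nat) :=
  @isMeasurable.Build default_measure_display 'I_n.+1 discrete_measurable
    discrete_measurable0 discrete_measurableC discrete_measurableU.

Section sampling.
Context {R : realType}.

Definition uniform_ord (n : nat) : set 'I_n.+1 -> \bar R :=
  mscale (n.+1%:R^-1)%:nng (msum (fun k => \d_(inord k : 'I_n.+1)) n.+1).

HB.instance Definition _ (n : nat) := Measure.on (@uniform_ord n).

Let uniform_ord_setT (n : nat) : @uniform_ord n setT = 1%E.
Proof.
rewrite /uniform_ord /mscale /= /msum.
transitivity (n.+1%:R^-1%:E * \sum_(i < n.+1) (1 : R)%:E)%E.
  by congr (_ * _)%E; apply: eq_bigr => i _; exact: diracT.
by rewrite sumEFin sumr_const card_ord -EFinM mulVf.
Qed.

HB.instance Definition _ (n : nat) :=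
  @Measure_isProbability.Build _ _ R (@uniform_ord n) (uniform_ord_setT n).

Context {d} {T : measurableType d}.

Definition cons_pair (n : nat) (x : T * n.-tuple T) : n.+1.-tuple T :=
  [tuple of x.1 :: x.2].

Let measurable_cons_pair (n : nat) :
  measurable_fun [set: T * n.-tuple T] (@cons_pair n).
Proof. exact: (measurable_cons measurable_fst measurable_snd). Qed.

HB.instance Definition _ (n : nat) :=
  isMeasurableFun.Build _ _ _ _ (@cons_pair n) (@measurable_cons_pair n).

(* law of [n] independent draws from [P] *)
Fixpoint iid (P : probability T R) (n : nat) : probability (n.-tuple T) R :=
  match n with
  | 0 => \d_[tuple]
  | m.+1 => distribution (P \x iid P m)%E (@cons_pair m)
  end.

End sampling.

Section differential_privacy.
Context {R : realType} {X : Type} {n : nat}.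

Definition neighbors (D D' : n.-tuple X) :=
  exists i, tnth D i <> tnth D' i /\
    forall j, j != i -> tnth D j = tnth D' j.

(* A mechanism maps a data set to the law of its output. *)
Definition differentially_private d (T : measurableType d) (eps delta : R)
    (A : n.-tuple X -> set T -> \bar R) :=
  forall D D', neighbors D D' -> forall S, measurable S ->
    (A D S <= (expR eps)%:E * A D' S + delta%:E)%E.

End differential_privacy.

Section noise_gd.
Context {R : realType} {X : Type} {p n : nat}.
Variables (C : set 'rV[R]_p) (grad : X -> 'rV[R]_p -> 'rV[R]_p).
Variables (L eps delta : R) (eta : nat -> R) (theta1 : 'rV[R]_p).

(* [n.+1] is the size of the data sets *)
Definition noise_sigma2 : R :=
  32 * L ^+ 2 * n.+1%:R ^+ 2 * ln (n.+1%:R / delta) * ln delta^-1 / eps ^+ 2.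

(* The randomness of one step is an index and a standard Gaussian vector,
   which is scaled here: [normal_prob 0 s] is not a point mass for [s = 0]. *)
Definition step_seed : Type := ('I_n.+1 * p.-tuple (measurableTypeR R))%type.

Definition noise_gd_step (D : n.+1.-tuple X) (t : nat) (theta : 'rV[R]_p)
    (w : step_seed) : 'rV[R]_p :=
  let b := Num.sqrt noise_sigma2 *: \row_j tnth w.2 j in
  l2proj C
    (theta - eta t *: (n.+1%:R *: grad (tnth D w.1) theta + b)).

Fixpoint noise_gd_from (D : n.+1.-tuple X) (t : nat) (theta : 'rV[R]_p)
    (ws : seq step_seed) : 'rV[R]_p :=
  match ws with
  | [::] => theta
  | w :: ws' => noise_gd_from D t.+1 (noise_gd_step D t theta w) ws'
  end.

Definition seed_law :
    probability ((n.+1 ^ 2).-1.-tuple ('I_n.+1 * p.-tuple (measurableTypeR R))%type) R :=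
  iid (@uniform_ord R n \x iid (normal_prob 0 1) p)%E (n.+1 ^ 2).-1.

Definition noise_gd (D : n.+1.-tuple X) : set 'rV[R]_p -> \bar R :=
  pushforward seed_law (fun ws => noise_gd_from D 1 theta1 ws).

End noise_gd.

(* Main.v *)
(** Renyi differential privacy, by induction on the number of remaining steps.
    For one step, the laws of (gradient + noise), rescaled by the standard
    deviation, are uniform mixtures of shifted Gaussians with densities [q], [q']
    with respect to the standard Gaussian (Cameron-Martin), and for neighbouring
    data sets a single component of the mixture changes.  A quadratic expansion
    of [y `^ (b + 1)] at [y = q / q' = 1], in which the linear term integrates
    to zero, bounds the moment [\int q (q / q') `^ b] by
    [1 + O(b ^ 2 m / N ^ 2)], [m] being the squared distance of the two shifts:
    the factor [1 / N ^ 2] is the gain from sampling and is what makes [N ^ 2]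
    steps affordable.
    If [f] and [g] are the probabilities, under the two data sets, of ending in a
    given event when starting from a given point, the invariant is
    [f <= x g + (1 / 4) B ^ k x ^ (- b)] for all [x > 0] simultaneously, with [B]
    the bound on the moment; it passes from [k] to [k + 1] steps because [x] may
    be replaced pointwise by [x q' / q].  Finally [x = exp eps] and
    [b = 2 ln (1 / delta) / eps]. *)

Require Import Defs.
From HB Require Import structures.
From mathcomp Require Import all_boot all_order all_algebra.
From mathcomp Require Import all_classical all_reals all_analysis.
From mathcomp Require Import measurable_realfun ring lra.

Set Implicit Arguments.
Unset Strict Implicit.
Unset Printing Implicit Defensive.

Import Order.TTheory GRing.Theory Num.Theory.
Import numFieldNormedType.Exports.

Local Open Scope classical_set_scope.
Local Open Scope ring_scope.

(** * Quadratic bounds for powers and mixtures *)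

Lemma eqW d (T : porderType d) (x y : T) : x = y -> (x <= y)%O.
Proof. by move->. Qed.

Lemma inv_powR (R : realType) (x b : R) : 0 <= x -> x^-1 `^ b = (x `^ b)^-1.
Proof. by move=> x0; rewrite -(powR_inv1 x0) -powRrM mulN1r powRN. Qed.

Lemma ln_ge1B (R : realType) (x : R) : 0 < x -> 1 - x^-1 <= ln x.
Proof.
move=> x0; have := @le_ln1Dx R (x^-1 - 1).
rewrite (addrC 1) subrK lnV ?posrE// ltrBrDr addrC subrr invr_gt0 => /(_ x0); lra.
Qed.

(** With [z ^ b = z * z ^ (b - 1)], this follows from [exp u >= 1 + u] at [u = (b - 1) ln z]
    together with [z ln z >= z - 1]. *)
Lemma bernoulli_powR (R : realType) (b z : R) :
  1 <= b -> 0 < z -> 1 + b * (z - 1) <= z `^ b.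
Proof.
move=> b1 z0; rewrite -(mulr_powRB1 (ltW z0)); last by lra.
have lnz := ln_ge1B z0.
have E : 1 + (b - 1) * ln z <= z `^ (b - 1).
  by rewrite /powR gt_eqF//; exact: expR_ge1Dx.
apply: le_trans (ler_wpM2l (ltW z0) E).
have : (z - 1) <= z * ln z.
  by apply: le_trans (ler_wpM2l (ltW z0) lnz); rewrite mulrBr mulfV ?gt_eqF// mulr1.
move=> H.
have {}H : (b - 1) * (z - 1) <= (b - 1) * (z * ln z).
  by rewrite ler_wpM2l// subr_ge0.
lra.
Qed.

(** Bernoulli's inequality at [y^-1], multiplied by [y ^ b]. *)
Lemma powR_tangent (R : realType) (b y : R) : 1 <= b -> 0 < y ->
  y `^ b - 1 <= b * y `^ (b - 1) * (y - 1).
Proof.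
move=> b1 y0; have y0' : y != 0 by rewrite gt_eqF.
have := @bernoulli_powR R b y^-1 b1; rewrite invr_gt0 => /(_ y0).
rewrite inv_powR ?(ltW y0)//.
move/(ler_wpM2l (powR_ge0 y b)); rewrite mulfV ?gt_eqF ?powR_gt0//.
rewrite mulrDr mulr1 mulrBr mulr1 [in X in X <= _ -> _]mulrBr.
rewrite (_ : y `^ b * (b * y^-1) = b * y `^ (b - 1)).
  rewrite (_ : y `^ b = y `^ (b - 1) * y); last first.
    by rewrite mulrC mulr_powRB1// ?ltW//; lra.
  move=> H; have -> : b * y `^ (b - 1) * (y - 1) =
      b * (y `^ (b - 1) * y) - b * y `^ (b - 1) by ring.
  lra.
by rewrite mulrCA powRB ?y0' ?implybT// powRr1 ?ltW.
Qed.

(** The tangent bound leaves [(k + 1) (y - 1) y ^ k], which splits into the linear term and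
    [(k + 1) (y - 1) (y ^ k - 1)]. For [y >= 1] the last factor is bounded by the tangent bound
    again; for [y < 1] Bernoulli's inequality is multiplied by the negative [y - 1]. The maximum
    covers both cases. *)
Lemma powR_quadratic_bound (R : realType) (k y : R) : 1 <= k -> 0 < y ->
  y `^ (k + 1) <= 1 + (k + 1) * (y - 1)
    + (k + 1) * k * (y - 1) ^+ 2 * Num.max 1 (y `^ (k - 1)).
Proof.
move=> k1 y0.
have H1 : y `^ (k + 1) - 1 <= (k + 1) * y `^ k * (y - 1).
  by have := @powR_tangent R (k + 1) y _ y0; rewrite addrK; apply; lra.
have P0 := powR_ge0 y (k - 1).
have H2 : (y - 1) * (y `^ k - 1) <= k * (y - 1) ^+ 2 * Num.max 1 (y `^ (k - 1)).
  have [y1|y1] := leP 1 y.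
    have := powR_tangent k1 y0.
    move=> /(ler_wpM2l (_ : 0 <= y - 1)); rewrite subr_ge0 => /(_ y1) H.
    apply: le_trans H _.
    have -> : (y - 1) * (k * y `^ (k - 1) * (y - 1)) =
        k * (y - 1) ^+ 2 * y `^ (k - 1) by ring.
    by apply: ler_wpM2l; [rewrite mulr_ge0 ?sqr_ge0//; lra|rewrite le_max lexx ?orbT].
  have := bernoulli_powR k1 y0.
  move=> H; apply: (@le_trans _ _ ((y - 1) * (k * (y - 1)))).
    by apply: ler_wnM2l; lra.
  have -> : (y - 1) * (k * (y - 1)) = k * (y - 1) ^+ 2 * 1 by ring.
  by apply: ler_wpM2l; [rewrite mulr_ge0 ?sqr_ge0//; lra|rewrite le_max lexx ?orbT].
have := @ler_wpM2l _ (k + 1) _ _ _ H2 => /(_ ltac:(lra)).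
lra.
Qed.

Definition mean (R : realType) (n : nat) (x : 'I_n.+1 -> R) : R :=
  n.+1%:R^-1 * \sum_i x i.

Lemma mean_gt0 (R : realType) (n : nat) (x : 'I_n.+1 -> R) :
  (forall i, 0 < x i) -> 0 < mean x.
Proof.
move=> x0; rewrite mulr_gt0// ?invr_gt0// big_ord_recl.
by rewrite ltr_wpDr//; apply: sumr_ge0 => i _; exact: ltW.
Qed.

Lemma mean_harmonic_le (R : realType) (n : nat) (x : 'I_n.+1 -> R) :
  (forall i, 0 < x i) -> (mean x)^-1 <= mean (fun i => (x i)^-1).
Proof.
move=> x0; have q0 := mean_gt0 x0; set q := mean x in q0 *.
(* [1/x] lies above its tangent at the mean *)
have H i : 2 / q - x i / q ^+ 2 <= (x i)^-1.
  have xi := x0 i.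
  rewrite -subr_ge0 (_ : _ - _ = (x i)^-1 * (1 - x i / q) ^+ 2); last first.
    by field; rewrite !gt_eqF.
  by rewrite mulr_ge0 ?invr_ge0 ?sqr_ge0// ltW.
have : n.+1%:R^-1 * \sum_i (2 / q - x i / q ^+ 2) <= mean (fun i => (x i)^-1).
  by apply: ler_wpM2l; [rewrite invr_ge0|exact: ler_sum].
apply: le_trans.
rewrite big_split/= sumr_const card_ord sumrN -mulr_suml -(mulr_natl (2 / q)).
rewrite mulrBr mulKf// (mulrA n.+1%:R^-1) -/(mean x) -/q.
by rewrite (_ : 2 / q - q / q ^+ 2 = q^-1)//; field; rewrite gt_eqF.
Qed.

Lemma mean_sub1 (R : realType) (n : nat) (x x' : 'I_n.+1 -> R) (k : 'I_n.+1) :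
  (forall j, j != k -> x j = x' j) -> mean x - mean x' = n.+1%:R^-1 * (x k - x' k).
Proof.
move=> xx'; rewrite /mean -mulrBr -sumrB (bigD1 k)//= big1 ?addr0// => j jk.
by rewrite xx'// subrr.
Qed.

(** The two means share all terms but one, and adding a common positive mass to numerator and
    denominator moves a ratio towards 1. So the ratio of the means is at most 1 or at most
    [x k / x' k]. *)
Lemma mean_ratio_powR_le (R : realType) (n : nat) (x x' : 'I_n.+1 -> R)
    (k : 'I_n.+1) (s : R) : 0 <= s ->
  (forall i, 0 < x i) -> (forall i, 0 < x' i) ->
  (forall j, j != k -> x j = x' j) ->
  Num.max 1 ((mean x / mean x') `^ s) <= 1 + (x k / x' k) `^ s.
Proof.
move=> s0 x0 x'0 xx'; have p0 := mean_gt0 x0; have q0 := mean_gt0 x'0.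
have d := mean_sub1 xx'.
rewrite ge_max lerDl powR_ge0/=.
have [uv|/ltW vu] := leP (x k) (x' k).
  have pq : mean x <= mean x'.
    by rewrite -subr_le0 d pmulr_rle0 ?invr_gt0// subr_le0.
  apply: (@le_trans _ _ (1 `^ s)); last by rewrite powR1 lerDl powR_ge0.
  apply: ge0_ler_powR => //; rewrite ?nnegrE//.
    by rewrite divr_ge0// ltW.
  by rewrite ler_pdivrMr// mul1r.
apply: (@le_trans _ _ ((x k / x' k) `^ s)); last by rewrite lerDr.
apply: ge0_ler_powR => //; rewrite ?nnegrE.
- by rewrite divr_ge0// ltW.
- by rewrite divr_ge0// ltW.
rewrite ler_pdivrMr// mulrAC ler_pdivlMr//.
have -> : mean x = mean x' + n.+1%:R^-1 * (x k - x' k) by rewrite -d addrC subrK.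
have : n.+1%:R^-1 * x' k <= mean x'.
  apply: ler_wpM2l; rewrite ?invr_ge0// (bigD1 k)//= lerDl.
  by apply: sumr_ge0 => i _; exact: ltW.
move=> H; have := vu; rewrite -subr_ge0 => /ler_wpM2l /(_ _ _ H).
move: (mean x') (n.+1%:R^-1) => q c; lra.
Qed.

(** The quadratic bound at [y = mean x / mean x'], multiplied by [mean x']. Since one entry changes,
    [mean x' * (y - 1)] carries a factor [1 / n.+1], whose square appears here. The harmonic mean
    inequality removes [mean x'] from the denominator, so that for Gaussian densities every
    remaining term has an explicit integral. *)
Lemma mean_powR_bound (R : realType) (n : nat) (x x' : 'I_n.+1 -> R)
    (k : 'I_n.+1) (b : R) : 1 <= b ->
  (forall i, 0 < x i) -> (forall i, 0 < x' i) ->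
  (forall j, j != k -> x j = x' j) ->
  mean x * (mean x / mean x') `^ b <=
    mean x' + (b + 1) * (mean x - mean x') + (b + 1) * b / n.+1%:R ^+ 2 *
      mean (fun i => (x k - x' k) ^+ 2 / x' i * (1 + (x k / x' k) `^ (b - 1))).
Proof.
move=> b1 x0 x'0 xx'; have p0 := mean_gt0 x0; have q0 := mean_gt0 x'0.
have y0 : 0 < mean x / mean x' by rewrite divr_gt0.
set y := mean x / mean x' in y0 *.
have -> : mean x = mean x' * y by rewrite /y mulrC divfK// gt_eqF.
have -> : mean x' * y * y `^ b = mean x' * y `^ (b + 1).
  by rewrite -mulrA -(@mulr_powRB1 _ y (b + 1)) ?addrK ?(ltW y0)//; lra.
have b0 : 0 <= (b + 1) * b by nra.
apply: le_trans (ler_wpM2l (ltW q0) (powR_quadratic_bound b1 y0)) _.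
rewrite mulrDr mulrDr mulr1 (_ : mean x' * ((b + 1) * (y - 1)) =
  (b + 1) * (mean x' * y - mean x')); last by ring.
rewrite lerD2l.
have dy : mean x' * (y - 1) = n.+1%:R^-1 * (x k - x' k).
  by rewrite mulrBr mulr1 -(mean_sub1 xx') /y mulrCA mulfV ?mulr1// gt_eqF.
have -> : mean x' * ((b + 1) * b * (y - 1) ^+ 2 * Num.max 1 (y `^ (b - 1))) =
    (b + 1) * b * ((mean x' * (y - 1)) ^+ 2 * (mean x')^-1 * Num.max 1 (y `^ (b - 1))).
  by field; rewrite gt_eqF.
rewrite dy -!(mulrA ((b + 1) * b)); apply: ler_wpM2l => //.
rewrite exprMn exprVn -!mulrA; apply: ler_wpM2l; first by rewrite invr_ge0.
have -> : mean (fun i => (x k - x' k) ^+ 2 / x' i * (1 + (x k / x' k) `^ (b - 1)))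
   = (x k - x' k) ^+ 2 * (mean (fun i => (x' i)^-1) * (1 + (x k / x' k) `^ (b - 1))).
  by rewrite /mean -mulr_suml -mulr_sumr; ring.
rewrite 2!mulrA -expr2 -mulrA.
apply: ler_wpM2l; first exact: sqr_ge0.
apply: ler_pM.
- by rewrite invr_ge0 ltW.
- by rewrite le_max ler01.
- exact: mean_harmonic_le.
- by apply: mean_ratio_powR_le; rewrite ?subr_ge0.
Qed.

(** * Numerical estimates *)

(** The left-hand side is the square of [exp (h / 2) - exp (- h / 2)], which for [h >= 0] is at most
    [h exp (h / 2)]. *)
Lemma expR_sym_le (R : realType) (h : R) :
  expR h + expR (- h) - 2 <= h ^+ 2 * expR `|h|.
Proof.
wlog h0 : h / 0 <= h => [hyp|].
  have [|/ltW] := leP 0 h; first exact: hyp.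
  by rewrite -oppr_ge0 => /hyp; rewrite opprK normrN sqrrN addrAC addrC addrA.
rewrite ger0_norm//.
have hh : expR h = expR (h / 2) ^+ 2 by rewrite -expRM_natr divfK.
have hN : expR (- h) = expR (- (h / 2)) ^+ 2 by rewrite -expRM_natr -mulNr divfK.
have -> : expR h + expR (- h) - 2 = (expR (h / 2) - expR (- (h / 2))) ^+ 2.
  have e1 := expRxMexpNx_1 (h / 2).
  by rewrite hh hN sqrrB e1; ring.
have B : expR (h / 2) - expR (- (h / 2)) <= h * expR (h / 2).
  have -> : expR (- (h / 2)) = expR (h / 2) * expR (- h).
    by rewrite -expRD; congr expR; field.
  rewrite -{1}[expR (h / 2)]mulr1 -mulrBr mulrC ler_pM2r ?expR_gt0//.
  have := expR_ge1Dx (- h); lra.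
rewrite hh -exprMn ler_sqr ?nnegrE//.
  by rewrite subr_ge0 ler_expR; lra.
by rewrite mulr_ge0// expR_ge0.
Qed.

(** Around the midpoint [c] of [E1] and [E3], with half-spread [h], the sum splits into
    [exp c * (exp h + exp (- h) - 2)], controlled by [h ^ 2], and [2 (exp c - exp E2)], controlled
    by [c - E2 = D / 2]. *)
Lemma expR_diff2_le (R : realType) (E1 E2 E3 M D : R) :
  D = E1 + E3 - 2 * E2 -> 0 <= D -> E1 <= M -> E3 <= M ->
  expR E1 + expR E3 - 2 * expR E2 <= (D + ((E1 - E3) / 2) ^+ 2) * expR M.
Proof.
move=> DE D0 E1M E3M; set h := (E1 - E3) / 2; set c := (E1 + E3) / 2.
have e1 : expR E1 = expR c * expR h by rewrite -expRD; congr expR; rewrite /c /h; field.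
have e3 : expR E3 = expR c * expR (- h).
  by rewrite -expRD; congr expR; rewrite /c /h; field.
have e2 : expR c - expR E2 <= D / 2 * expR c.
  have -> : expR E2 = expR c * expR (- (D / 2)).
    by rewrite -expRD; congr expR; rewrite /c DE; field.
  rewrite -{1}[expR c]mulr1 -mulrBr mulrC ler_pM2r ?expR_gt0//.
  have := expR_ge1Dx (- (D / 2)); lra.
have cM : expR c <= expR M by rewrite ler_expR /c; lra.
have hM : expR c * expR `|h| <= expR M.
  by rewrite -expRD ler_expR /c /h; case: (ler0P ((E1 - E3) / 2)) => _; lra.
have H1 : expR c * (expR h + expR (- h) - 2) <= h ^+ 2 * expR M.
  apply: le_trans (ler_wpM2l (expR_ge0 c) (expR_sym_le h)) _.
  by rewrite mulrCA ler_wpM2l// sqr_ge0.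
have H2 : D * expR c <= D * expR M by rewrite ler_wpM2l.
rewrite e1 e3 mulrDl; lra.
Qed.

(* For Gaussian shifts [a], [a'], [c] with densities [u], [v], [w] and squared
   distances [A = |a - c|^2], [A' = |a' - c|^2], [D = |a - a'|^2], the integral of
   [u ^ 2 (u / v) ^ t / w] is [expR (E t)]; the left-hand side is therefore the
   integral of [(u - v) ^ 2 (u / v) ^ s / w]. *)
Lemma gauss_exponent_bound (R : realType) (A A' D m s : R) (E : R -> R) :
  0 <= s -> 0 <= A <= m -> 0 <= A' <= m -> 0 <= D <= m ->
  (forall t, E t = t * (t + 2) / 2 * D + (1 + t / 2) * A - t / 2 * A') ->
  expR (E s) + expR (E (s - 2)) - 2 * expR (E (s - 1)) <=
  m * (1 + (s + 2^-1) ^+ 2 * m) * expR ((s + 1) * (s + 2) * m / 2).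
Proof.
move=> s0 /andP[A0 Am] /andP[A'0 A'm] /andP[D0 Dm] EE.
set M := (s + 1) * (s + 2) * m / 2.
have m0 : 0 <= m by lra.
have sm : 0 <= s * m by rewrite mulr_ge0.
have ssm : 0 <= s * (s * m) by rewrite mulr_ge0.
have sD : s * D <= s * m by rewrite ler_wpM2l.
have sA : s * A <= s * m by rewrite ler_wpM2l.
have sA' : s * A' <= s * m by rewrite ler_wpM2l.
have sA0 : 0 <= s * A by rewrite mulr_ge0.
have sA'0 : 0 <= s * A' by rewrite mulr_ge0.
have sD0 : 0 <= s * D by rewrite mulr_ge0.
have ssD : s * (s * D) <= s * (s * m) by rewrite ler_wpM2l.
have E1 : E s <= M by rewrite EE /M; lra.
have E3 : E (s - 2) <= M.
  (* The coefficients of [D] and [A'] in [E (s - 2)] are [s (s - 2) / 2] and [(2 - s) / 2]; both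
     change sign at [s = 2]. *)
  rewrite EE /M; have [s2|/ltW s2] := leP 2 s.
    have : 0 <= (s - 2) * A' by rewrite mulr_ge0// subr_ge0.
    lra.
  have H1 : (2 - s) * A' <= (2 - s) * m by rewrite ler_wpM2l// subr_ge0.
  have H2 : 0 <= (2 - s) * (s * D) by rewrite mulr_ge0// subr_ge0.
  lra.
have DE : D = E s + E (s - 2) - 2 * E (s - 1) by rewrite !EE; field.
apply: le_trans (expR_diff2_le DE D0 E1 E3) _.
rewrite -/M ler_wpM2r ?expR_ge0// mulrDr mulr1 lerD//.
(* This half difference is at most [(s + 1 / 2) m] in absolute value, whence the factor
   [(s + 2^-1) ^+ 2]. *)
have -> : (E s - E (s - 2)) / 2 = s * D + (A - A') / 2 by rewrite !EE; field.
have -> : m * ((s + 2^-1) ^+ 2 * m) = (s * m + m / 2) ^+ 2 by field.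
rewrite -(real_normK (num_real (s * D + _))) ler_sqr ?nnegrE//; last by lra.
by rewrite ler_norml; apply/andP; split; lra.
Qed.

(** Equivalently [exp (- 17 / 25) >= 1 / 2]. This is the 32nd power of
    [exp (- 17 / 800) >= 783 / 800], reached by five squarings, rounded down on the way. *)
Lemma ln2_lbound (R : realType) : 17 / 25 <= ln (2 : R).
Proof.
rewrite -(expRK (17 / 25)) ler_ln ?posrE ?expR_gt0//.
have e0 : 0 < expR (- (17 / 800)) :> R by exact: expR_gt0.
have e1 : 783 / 800 <= expR (- (17 / 800)) :> R.
  by apply: le_trans (expR_ge1Dx _); lra.
have sq (a b c : R) : a <= b -> 0 <= a -> c <= a ^+ 2 -> c <= b ^+ 2.
  by move=> ab a0 /le_trans; apply; rewrite ler_sqr// nnegrE// (le_trans a0).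
have : 2^-1 <= expR (- (17 / 25)) :> R.
  have -> : - (17 / 25) = - (17 / 800) * 32%:R :> R by lra.
  rewrite expRM_natr (_ : 32 = 2 * 2 * 2 * 2 * 2)%N// !exprM.
  move: (expR _) {e0} e1 => x /(sq _ _ (9579 / 10000)) h.
  have {h} : 9579 / 10000 <= x ^+ 2 by apply: h; lra.
  move: (x ^+ 2) => {}x /(sq _ _ (9175 / 10000)) h.
  have {h} : 9175 / 10000 <= x ^+ 2 by apply: h; lra.
  move: (x ^+ 2) => {}x /(sq _ _ (8418 / 10000)) h.
  have {h} : 8418 / 10000 <= x ^+ 2 by apply: h; lra.
  move: (x ^+ 2) => {}x /(sq _ _ (7086 / 10000)) h.
  have {h} : 7086 / 10000 <= x ^+ 2 by apply: h; lra.
  by move=> /(sq _ _ 2^-1); apply; lra.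
by rewrite expRN lef_pV2 ?posrE ?expR_gt0.
Qed.

(** The exponent may exceed [l] by [2 ln 2] because the invariant starts with the factor [1 / 4].
    With [t = l / (l + ln 2)], which dominates [y], and [exp (y / 2) <= 1 / (1 - t / 2)], the claim
    becomes a polynomial inequality in [l] and [ln 2]. *)
Lemma budget_exponent_le (R : realType) (l L y : R) :
  0 < l -> l + ln 2 <= L -> 0 <= y -> y <= l / L ->
  y * (2 + y) * expR (y / 2) <= l + 2 * ln 2.
Proof.
move=> l0 lL y0 yl; have m68 := @ln2_lbound R; set m := ln 2 in lL m68 *.
pose t := l / (l + m).
have lm : 0 < l + m by lra.
have t0 : 0 <= t by rewrite divr_ge0//; lra.
have t1 : t < 1 by rewrite ltr_pdivrMr//; lra.
have yt : y <= t.
  by apply: le_trans yl _; rewrite ler_pM2l// lef_pV2 ?posrE//; lra.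
have e1 : expR (y / 2) <= (1 - t / 2)^-1.
  rewrite -[leLHS]invrK lef_pV2 ?posrE ?invr_gt0 ?expR_gt0//; last by lra.
  rewrite -expRN; apply: le_trans (expR_ge1Dx _); lra.
apply: (@le_trans _ _ (t * (2 + t) * (1 - t / 2)^-1)).
  apply: ler_pM => //; rewrite ?expR_ge0//.
    by rewrite mulr_ge0// addr_ge0.
  by apply: ler_pM => //; rewrite ?lerD2l// addr_ge0.
have -> : t * (2 + t) * (1 - t / 2)^-1 =
    2 * l * (3 * l + 2 * m) / ((l + m) * (l + 2 * m)).
  by rewrite /t; field; rewrite !gt_eqF//; lra.
rewrite ler_pdivrMr; last by rewrite mulr_gt0//; lra.
have [d d0 ->] : exists2 d, 0 <= d & m = 17 / 25 + d.
  by exists (m - 17 / 25); [rewrite subr_ge0|rewrite addrC subrK].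
have dl := mulr_ge0 d0 (ltW l0); have dd := mulr_ge0 d0 d0.
have dll := mulr_ge0 dl (ltW l0); have ddl := mulr_ge0 dd (ltW l0).
have ddd := mulr_ge0 dd d0.
(* The difference of the two sides is increasing in [m], and for [m = 17 / 25] it
   is this cubic plus a positive affine function of [l]. *)
have : 0 <= (l + 23 / 50) * (l - 153 / 100) ^+ 2.
  by rewrite mulr_ge0 ?sqr_ge0//; lra.
lra.
Qed.

Lemma expn_1Ddiv_le (R : realType) (c : R) (a T : nat) :
  0 <= c -> (0 < a)%N -> (T <= a)%N -> (1 + c / a%:R) ^+ T <= expR c.
Proof.
move=> c0 a0 Ta; have a0' : 0 < a%:R :> R by rewrite ltr0n.
have c1 : 1 <= 1 + c / a%:R by rewrite lerDl divr_ge0// ltW.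
apply: (@le_trans _ _ ((1 + c / a%:R) ^+ a)); first by rewrite ler_weXn2l.
rewrite -[in leRHS](divfK (lt0r_neq0 a0') c) expRM_natr.
by rewrite lerXn2r ?nnegrE ?expR_ge0 ?expR_ge1Dx// (le_trans ler01).
Qed.

(** * Gaussian shifts *)

Section density.
Local Open Scope ereal_scope.
Import HBNNSimple.

(** Checked on simple functions, then extended by monotone convergence. *)
Lemma ge0_integral_density d (T : measurableType d) (R : realType)
    (mu nu : {measure set T -> \bar R}) (g : T -> R) (f : T -> \bar R) :
  measurable_fun setT g -> (forall x, (0 <= g x)%R) ->
  (forall A, measurable A -> nu A = \int[mu]_(x in A) (g x)%:E) ->
  measurable_fun setT f -> (forall x, 0 <= f x) ->
  \int[nu]_x f x = \int[mu]_x (f x * (g x)%:E).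
Proof.
move=> mg g0 nuE mf f0; have mg' := (measurable_EFinP _ _).2 mg.
pose h := nnsfun_approx measurableT mf.
have nnsfunE (s : {nnsfun T >-> R}) :
    \int[nu]_x (s x)%:E = \int[mu]_x ((s x)%:E * (g x)%:E).
  under [LHS]eq_integral do rewrite fimfunE -fsumEFin//.
  rewrite ge0_integral_fsum//; last 2 first.
    by move=> r; exact/measurable_EFinP/measurableT_comp.
    by move=> n x _; rewrite EFinM nnfun_muleindic_ge0.
  under [RHS]eq_integral.
    move=> x xD; rewrite fimfunE -fsumEFin// ge0_mule_fsuml; last first.
      by move=> r; rewrite EFinM nnfun_muleindic_ge0.
    over.
  rewrite ge0_integral_fsum//; last 2 first.
  - move=> r; apply: emeasurable_funM => //.
    exact/measurable_EFinP/measurableT_comp.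
  - by move=> n x _; rewrite mule_ge0 ?lee_fin//; exact: (nnfun_muleindic_ge0 s).
  apply: eq_fsbigr => r /[!inE] -[x _ <-].
  under [LHS]eq_integral do rewrite EFinM.
  rewrite integralZl_indic_nnsfun// integral_indic//= setIT.
  under [RHS]eq_integral do rewrite EFinM -muleA.
  rewrite ge0_integralZl//; last 3 first.
  - by apply: emeasurable_funM => //; exact/measurable_EFinP.
  - by move=> y _; rewrite mule_ge0// lee_fin.
  - by rewrite lee_fin.
  rewrite nuE// [in LHS]integral_mkcond; congr (_ * _).
  apply: eq_integral => y _; rewrite patchE indicE.
  by case: ifPn => _; rewrite ?mul1e ?mul0e.
have fE x : EFin \o h ^~ x @ \oo --> f x by exact: cvg_nnsfun_approx.
transitivity (lim (\int[nu]_x (h n x)%:E @[n --> \oo])).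
  rewrite -monotone_convergence//.
  - by apply: eq_integral => x _; apply/esym/cvg_lim => //; exact: fE.
  - by move=> n; exact/measurable_EFinP.
  - by move=> n x _; rewrite lee_fin.
  - by move=> x _ a b ab; rewrite lee_fin; exact/lefP/nd_nnsfun_approx.
under eq_fun do rewrite nnsfunE.
rewrite -monotone_convergence//.
- apply: eq_integral => x _; apply/cvg_lim => //.
  by apply: cvgeZr => //; exact: fE.
- by move=> n; apply: emeasurable_funM => //; exact/measurable_EFinP.
- by move=> n x _; rewrite mule_ge0 ?lee_fin.
- move=> x _ a b ab; rewrite lee_wpmul2r ?lee_fin//.
  exact/lefP/nd_nnsfun_approx.
Qed.

(** The image of Lebesgue measure under a translation agrees with it on half-open intervals, hence
    everywhere. *)
Lemma ge0_integral_shift (R : realType) (a : R) (f : R -> \bar R) :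
  measurable_fun setT f -> (forall x, 0 <= f x) ->
  \int[lebesgue_measure]_x f (x + a)%R = \int[lebesgue_measure]_x f x.
Proof.
move=> mf f0.
have mphi : measurable_fun setT
    (fun x : measurableTypeR R => (x + a)%R : measurableTypeR R).
  exact: measurable_funD.
pose phi : {mfun measurableTypeR R >-> measurableTypeR R} :=
  HB.pack (fun x : measurableTypeR R => (x + a)%R : measurableTypeR R)
    (isMeasurableFun.Build _ _ _ _ _ mphi).
transitivity (\int[pushforward (@lebesgue_measure R) phi]_x f x).
  by rewrite ge0_integral_pushforward.
apply: eq_measure_integral => A mA _.
apply/esym/lebesgue_measure_unique => //= _ [[x y]] _ <-.
rewrite /pushforward.
have -> : phi @^-1` `]x, y] = `](x - a)%R, (y - a)%R]%classic.
  by apply/seteqP; split => z /=; rewrite !in_itv/= ltrBlDr lerBrDr.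
rewrite !lebesgue_measure_itv/= !lte_fin ltrD2r.
by case: ifPn => // _; congr EFin; rewrite opprB addrA subrK.
Qed.

Lemma ge0_integral_normal_prob (R : realType) (f : R -> \bar R) :
  measurable_fun setT f -> (forall x, 0 <= f x) ->
  \int[normal_prob 0 1]_x f x =
  \int[lebesgue_measure]_x (f x * (normal_pdf 0 1 x)%:E).
Proof.
move=> mf f0; apply: ge0_integral_density => //.
- exact: measurable_normal_pdf.
- by move=> x; exact: normal_pdf_ge0.
Qed.

(** Cameron-Martin in dimension one: translation invariance of Lebesgue measure, then completion of
    the square in the Gaussian exponent. *)
Lemma ge0_integral_normal_shift (R : realType) (a : R) (f : R -> \bar R) :
  measurable_fun setT f -> (forall x, 0 <= f x) ->
  \int[normal_prob 0 1]_x f (x + a)%R =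
  \int[normal_prob 0 1]_x (f x * (expR (a * x - a ^+ 2 / 2))%:E).
Proof.
move=> mf f0.
have m1 : measurable_fun setT (fun x : R => (expR (a * x - a ^+ 2 / 2))%:E).
  apply/measurable_EFinP; apply: measurableT_comp => //.
  by apply: measurable_funB => //; exact: measurable_funM.
have mpdf : measurable_fun setT (fun x => (normal_pdf (0 : R) 1 x)%:E).
  by apply/measurable_EFinP; exact: measurable_normal_pdf.
have mfa : measurable_fun setT (fun x : R => f (x + a)%R).
  by apply: measurableT_comp => //; exact: measurable_funD.
rewrite ge0_integral_normal_prob// ge0_integral_normal_prob; last 2 first.
- exact: emeasurable_funM.
- by move=> x; rewrite mule_ge0// lee_fin expR_ge0.
rewrite -[RHS](@ge0_integral_shift R a); last 2 first.
- by apply: emeasurable_funM => //; exact: emeasurable_funM.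
- by move=> x; rewrite !mule_ge0// lee_fin ?expR_ge0// normal_pdf_ge0.
apply: eq_integral => x _.
rewrite -muleA -EFinM; congr (_ * EFin _).
rewrite !normal_pdfE ?oner_neq0// mulrCA; congr (_ * _)%R.
by rewrite /normal_fun -expRD; congr expR; rewrite !subr0 expr1n; field.
Qed.
End density.

Section gaussian.
Local Open Scope ereal_scope.

(** The density of the Gaussian law with mean [a] and identity covariance with respect to the
    standard one. *)
Definition gauss_tilt (R : realType) (p : nat) (a : 'I_p -> R)
    (z : p.-tuple (measurableTypeR R)) : R :=
  expR (\sum_j a j * tnth z j - (\sum_j a j * a j) / 2)%R.

Definition tuple_shift (R : realType) (p : nat) (a : 'I_p -> R)
    (z : p.-tuple (measurableTypeR R)) : p.-tuple (measurableTypeR R) :=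
  [tuple (tnth z j + a j)%R | j < p].

Lemma gauss_tilt_gt0 (R : realType) (p : nat) (a : 'I_p -> R) z :
  (0 < gauss_tilt a z)%R.
Proof. exact: expR_gt0. Qed.

Lemma measurable_gauss_tilt (R : realType) (p : nat) (a : 'I_p -> R) :
  measurable_fun setT (gauss_tilt a).
Proof.
apply: measurableT_comp => //; apply: measurable_funB => //.
apply: measurable_sum => j; apply: measurable_funM => //.
exact: measurable_tnth.
Qed.

Lemma measurable_tuple_shift (R : realType) (p : nat) (a : 'I_p -> R) :
  measurable_fun setT (tuple_shift a).
Proof.
apply/measurable_fun_tnthP => j.
rewrite (_ : _ \o _ = fun z => tnth z j + a j)%R.
  by apply: measurable_funD => //; exact: measurable_tnth.
by apply/funext => z /=; rewrite tnth_mktuple.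
Qed.

Lemma ge0_integral_iid_cons d (T : measurableType d) (R : realType)
    (P : probability T R) (n : nat) (f : n.+1.-tuple T -> \bar R) :
  measurable_fun setT f -> (forall z, 0 <= f z) ->
  \int[iid P n.+1]_z f z =
  \int[P]_x \int[iid P n]_t f [tuple of x :: t].
Proof.
move=> mf f0.
rewrite [LHS]ge0_integral_distribution//.
rewrite fubini_tonelli1//; last by move=> x; exact: f0.
by apply: measurableT_comp.
Qed.

(** Induction on the dimension: Tonelli splits off the first coordinate, and both the shift and the
    tilt factor accordingly. *)
Lemma ge0_integral_gauss_shift (R : realType) (p : nat) (a : 'I_p -> R)
    (f : p.-tuple (measurableTypeR R) -> \bar R) :
  measurable_fun setT f -> (forall z, 0 <= f z) ->
  \int[iid (normal_prob 0 1) p]_z f (tuple_shift a z) =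
  \int[iid (normal_prob 0 1) p]_z (f z * (gauss_tilt a z)%:E).
Proof.
elim: p a f => [|p IH] a f mf f0.
  apply: eq_integral => z _; rewrite /gauss_tilt !big_ord0 mul0r subr0 expR0 mule1.
  by congr f; apply: eq_from_tnth => -[].
rewrite ge0_integral_iid_cons//; last first.
  by apply: measurableT_comp => //; exact: measurable_tuple_shift.
rewrite ge0_integral_iid_cons//; last 2 first.
- apply: emeasurable_funM => //; apply/measurable_EFinP.
  exact: measurable_gauss_tilt.
- by move=> z; rewrite mule_ge0// lee_fin ltW// gauss_tilt_gt0.
pose a' (j : 'I_p) : R := a (lift ord0 j).
have consE (x : measurableTypeR R) (t : p.-tuple (measurableTypeR R)) :
  tuple_shift a [tuple of x :: t] =
    [tuple of (x + a ord0)%R :: tuple_shift a' t].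
  apply: eq_from_tnth => j; rewrite tnth_mktuple.
  by have [k ->|->] := unliftP ord0 j; rewrite ?tnthS ?tnth0// tnth_mktuple.
have tiltE (x : measurableTypeR R) (t : p.-tuple (measurableTypeR R)) :
  gauss_tilt a [tuple of x :: t] =
    (expR (a ord0 * x - a ord0 ^+ 2 / 2) * gauss_tilt a' t)%R.
  rewrite /gauss_tilt !big_ord_recl -expRD; congr expR.
  under eq_bigr do rewrite tnthS.
  by rewrite tnth0 expr2; ring.
have mcons : measurable_fun setT
    (fun xt : measurableTypeR R * p.-tuple (measurableTypeR R) =>
       f [tuple of xt.1 :: xt.2]).
  by apply: measurableT_comp => //; exact: measurable_cons.
have mc x : measurable_fun setT
    (fun t : p.-tuple (measurableTypeR R) => f [tuple of x :: t]).
  by apply: measurableT_comp => //; exact: measurable_cons.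
have mt := @measurable_gauss_tilt R p a'.
under eq_integral do under eq_integral do rewrite consE.
under eq_integral => x _ do
  rewrite (IH a' (fun t => f [tuple of (x + a ord0)%R :: t]))//.
pose F (x : measurableTypeR R) : \bar R :=
  \int[iid (normal_prob 0 1) p]_t (f [tuple of x :: t] * (gauss_tilt a' t)%:E).
pose G (xt : measurableTypeR R * p.-tuple (measurableTypeR R)) : \bar R :=
  f [tuple of xt.1 :: xt.2] * (gauss_tilt a' xt.2)%:E.
have mF : measurable_fun setT F.
  apply: (measurable_fun_fubini_tonelli_F (m2 := iid (normal_prob 0 1) p) G).
  - apply: emeasurable_funM => //; apply/measurable_EFinP.
    exact: measurableT_comp.
  - by move=> x; rewrite mule_ge0// lee_fin ltW// gauss_tilt_gt0.
have F0 x : 0 <= F x.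
  by apply: integral_ge0 => t _; rewrite mule_ge0// lee_fin ltW// gauss_tilt_gt0.
transitivity (\int[normal_prob 0 1]_x
    (F x * (expR (a ord0 * x - a ord0 ^+ 2 / 2))%:E)).
  exact: (@ge0_integral_normal_shift R (a ord0) F mF F0).
apply: eq_integral => x _.
under [RHS]eq_integral do rewrite tiltE EFinM muleCA.
rewrite muleC ge0_integralZl//.
- by apply: emeasurable_funM => //; exact/measurable_EFinP.
- by move=> t _; rewrite mule_ge0// lee_fin ltW// gauss_tilt_gt0.
Qed.

Lemma integral_gauss_tilt (R : realType) (p : nat) (a : 'I_p -> R) :
  \int[iid (normal_prob 0 1) p]_z (gauss_tilt a z)%:E = 1.
Proof.
transitivity (\int[iid (normal_prob 0 1) p]_z (cst 1 z * (gauss_tilt a z)%:E)).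
  by apply: eq_integral => z _; rewrite mul1e.
rewrite -(ge0_integral_gauss_shift a)// integral_cst// mul1e.
exact: probability_setT.
Qed.
End gaussian.

(** * The moment of one step *)

Section has_integral.
Context d (T : measurableType d) (R : realType) (P : probability T R).
Implicit Types (f g : T -> R) (r s : R).
Local Open Scope ereal_scope.

(** Integrability is kept together with a finite value, so that combinations with negative
    coefficients can be integrated termwise. *)
Definition has_integral f r :=
  P.-integrable setT (EFin \o f) /\ \int[P]_x (f x)%:E = r%:E.

Lemma has_integralD f g r s :
  has_integral f r -> has_integral g s -> has_integral (fun x => f x + g x)%R (r + s).
Proof.
move=> [fi fr] [gi gs]; split.
  by have := integrableD measurableT fi gi; apply: eq_integrable.
under eq_integral do rewrite EFinD.
by rewrite integralD// fr gs.
Qed.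

Lemma has_integralZ k f r :
  has_integral f r -> has_integral (fun x => k * f x)%R (k * r).
Proof.
move=> [fi fr]; split.
  by have := integrableZl measurableT k fi; apply: eq_integrable.
under eq_integral do rewrite EFinM.
by rewrite integralZl// fr.
Qed.

Lemma has_integralB f g r s :
  has_integral f r -> has_integral g s -> has_integral (fun x => f x - g x)%R (r - s).
Proof.
move=> fr /(has_integralZ (-1)) /(has_integralD fr); rewrite mulN1r.
by under [X in has_integral X]eq_fun do rewrite mulN1r.
Qed.

Lemma has_integral0 : has_integral (fun=> 0%R) 0.
Proof. by split; [exact: integrable0|rewrite integral0]. Qed.

Lemma has_integral_mean n (f : 'I_n.+1 -> T -> R) (r : 'I_n.+1 -> R) :
  (forall i, has_integral (f i) (r i)) ->
  has_integral (fun x => mean (fun i => f i x)) (mean r).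
Proof.
move=> fr; apply: has_integralZ.
elim: (index_enum _) => [|i e IH].
  by under eq_fun do rewrite big_nil; rewrite big_nil; exact: has_integral0.
under eq_fun do rewrite big_cons; rewrite big_cons.
exact: has_integralD.
Qed.
End has_integral.

Lemma has_integral_gauss_tilt (R : realType) (p : nat) (a : 'I_p -> R) :
  has_integral (iid (normal_prob 0 1) p) (gauss_tilt a) 1.
Proof.
split; last exact: integral_gauss_tilt.
apply/integrableP; split.
  by apply/measurable_EFinP; exact: measurable_gauss_tilt.
under eq_integral => z _ do rewrite /= ger0_norm ?(ltW (gauss_tilt_gt0 a z))//.
by rewrite integral_gauss_tilt ltry.
Qed.

(** The integrand is the exponential of an affine function of [z], hence a constant times the tilt
    by [v = (2 + t) a - t a' - c]. The tilt integrates to 1, and the constant comes from completing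
    the square. *)
Lemma has_integral_gauss_tilt_powR (R : realType) (p : nat)
    (a a' c : 'I_p -> R) (t : R) :
  has_integral (iid (normal_prob 0 1) p)
    (fun z => gauss_tilt a z ^+ 2 * (gauss_tilt a z / gauss_tilt a' z) `^ t
       / gauss_tilt c z)
    (expR (t * (t + 2) / 2 * (\sum_j (a j - a' j) ^+ 2)
      + (1 + t / 2) * (\sum_j (a j - c j) ^+ 2) - t / 2 * (\sum_j (a' j - c j) ^+ 2))).
Proof.
set E := expR _; pose v j := (2 + t) * a j - t * a' j - c j.
have Sv (z : p.-tuple (measurableTypeR R)) : \sum_j v j * tnth z j =
    (2 + t) * (\sum_j a j * tnth z j) - t * (\sum_j a' j * tnth z j)
      - \sum_j c j * tnth z j.
  rewrite !mulr_sumr -!sumrB; apply: eq_bigr => j _.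
  by rewrite /v; move: (tnth z j) => x; ring.
have Qv : (\sum_j v j * v j) / 2 =
    ((2 + t) / 2 * (\sum_j a j * a j) - t / 2 * (\sum_j a' j * a' j)
      - 2^-1 * (\sum_j c j * c j))
    + (t * (t + 2) / 2 * (\sum_j (a j - a' j) ^+ 2)
      + (1 + t / 2) * (\sum_j (a j - c j) ^+ 2) - t / 2 * (\sum_j (a' j - c j) ^+ 2)).
  rewrite !mulr_sumr !mulr_suml -!sumrB -!big_split/= -!sumrB -!big_split/=.
  by apply: eq_bigr => j _; rewrite /v; field.
rewrite -[E]mulr1.
under eq_fun => z.
  have -> : gauss_tilt a z ^+ 2 * (gauss_tilt a z / gauss_tilt a' z) `^ t
      / gauss_tilt c z
      = E * gauss_tilt v z.
    rewrite /gauss_tilt -expRB -expRM -expRM_natr -expRD -expRB -expRD; congr expR.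
    by rewrite Sv Qv; field.
  over.
by apply: has_integralZ; exact: has_integral_gauss_tilt.
Qed.

Lemma sum_sqrB_le (R : realType) (p : nat) (a b : 'I_p -> R) (m : R) :
  \sum_j a j ^+ 2 <= m / 4 -> \sum_j b j ^+ 2 <= m / 4 ->
  0 <= \sum_j (a j - b j) ^+ 2 <= m.
Proof.
move=> am bm; rewrite sumr_ge0 => [|j _]; last exact: sqr_ge0.
apply: (@le_trans _ _ (2 * \sum_j a j ^+ 2 + 2 * \sum_j b j ^+ 2)); last by lra.
rewrite !mulr_sumr -big_split/=; apply: ler_sum => j _.
have := sqr_ge0 (a j + b j); lra.
Qed.

(** The bound [B] of the overview on the one-step moment, for order [k] and squared distance at most
    [m] between shifts. *)
Definition step_growth (R : realType) (n : nat) (k m : R) : R :=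
  let y := (k + 1) * k * m in
  1 + y * (2 + y) * expR (y / 2) / n.+1%:R ^+ 2.

(** The moment is not integrated itself: [h] dominates it pointwise and, being a signed combination
    of Gaussian tilts, has an explicit integral. The radius condition [m / 4] makes any two shifts
    lie at squared distance at most [m]. *)
Lemma gauss_mixture_moment (R : realType) (n p : nat)
    (a a' : 'I_n.+1 -> 'I_p -> R) (k : 'I_n.+1) (b m : R) :
  1 <= b -> (forall j, j != k -> a j = a' j) ->
  (forall i, \sum_j a i j ^+ 2 <= m / 4) ->
  (forall i, \sum_j a' i j ^+ 2 <= m / 4) ->
  exists (h : p.-tuple (measurableTypeR R) -> R) (r : R),
  [/\ has_integral (iid (normal_prob 0 1) p) h r, r <= step_growth n b m &
   forall z, let q := mean (fun i => gauss_tilt (a i) z) in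
     let q' := mean (fun i => gauss_tilt (a' i) z) in
     q * (q / q') `^ b <= h z].
Proof.
move=> b1 aa' am a'm; set s := b - 1.
pose u := gauss_tilt (a k); pose v := gauss_tilt (a' k).
(* [u] and [v] are the densities of the changed component; [S i] is
   [(u - v) ^ 2 / w * (1 + (u / v) ^ s)] with [w] the density of component [i],
   expanded into products of powers of Gaussian densities. *)
pose T t i z := u z ^+ 2 * (u z / v z) `^ t / gauss_tilt (a' i) z.
pose E i t := t * (t + 2) / 2 * (\sum_j (a k j - a' k j) ^+ 2)
  + (1 + t / 2) * (\sum_j (a k j - a' i j) ^+ 2)
  - t / 2 * (\sum_j (a' k j - a' i j) ^+ 2).
pose S i z := (T 0 i z + T (0 - 2) i z - 2 * T (0 - 1) i z)
  + (T s i z + T (s - 2) i z - 2 * T (s - 1) i z).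
pose r i := (expR (E i 0) + expR (E i (0 - 2)) - 2 * expR (E i (0 - 1)))
  + (expR (E i s) + expR (E i (s - 2)) - 2 * expR (E i (s - 1))).
pose c := (b + 1) * b / n.+1%:R ^+ 2.
have hT t i : has_integral (iid (normal_prob 0 1) p) (T t i) (expR (E i t)).
  exact: has_integral_gauss_tilt_powR.
exists (fun z => mean (fun i => gauss_tilt (a' i) z) + (b + 1) *
     (mean (fun i => gauss_tilt (a i) z) - mean (fun i => gauss_tilt (a' i) z))
     + c * mean (fun i => S i z)).
exists (mean (fun _ : 'I_n.+1 => 1) + (b + 1) *
     (mean (fun _ : 'I_n.+1 => 1) - mean (fun _ : 'I_n.+1 => 1)) + c * mean r).
have h1 (w : 'I_n.+1 -> 'I_p -> R) : has_integral (iid (normal_prob 0 1) p)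
    (fun z => mean (fun i => gauss_tilt (w i) z)) (mean (fun _ : 'I_n.+1 => 1)).
  by apply: has_integral_mean => i; exact: has_integral_gauss_tilt.
have c0 : 0 <= c by rewrite /c divr_ge0 ?exprn_ge0// mulr_ge0//; lra.
split.
- apply: has_integralD.
    by apply: has_integralD => //; apply: has_integralZ; exact: has_integralB.
  apply: has_integralZ; apply: has_integral_mean => i.
  by apply: has_integralD; apply: has_integralB;
    [exact: has_integralD|exact: has_integralZ
    |exact: has_integralD|exact: has_integralZ].
- have -> : mean (fun _ : 'I_n.+1 => 1) = 1 :> R.
    by rewrite /mean sumr_const card_ord mulVf.
  rewrite subrr mulr0 addr0 /step_growth lerD2l.
  set y := (b + 1) * b * m.
  have m0 : 0 <= m.
    have : 0 <= \sum_j a k j ^+ 2 by apply: sumr_ge0 => j _; exact: sqr_ge0.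
    by have := am k; lra.
  have rE i : r i <= m * (2 + y) * expR (y / 2).
    have s0 : 0 <= s by rewrite subr_ge0.
    have A := sum_sqrB_le (am k) (a'm i).
    have A' := sum_sqrB_le (a'm k) (a'm i).
    have D := sum_sqrB_le (am k) (a'm k).
    (* [B1] treats the summand 1 and [B2] the summand [(u / v) ^ s] of [1 + (u / v) ^ s]. They add
       up to the claim since [1 / 4 + (b - 1 / 2) ^ 2 <= (b + 1) b]. *)
    have B1 := gauss_exponent_bound (lexx 0) A A' D (E := E i) (fun t => erefl).
    have B2 := gauss_exponent_bound s0 A A' D (E := E i) (fun t => erefl).
    have bm : m <= b * m by rewrite ler_peMl.
    have bbm : b * m <= b * (b * m) by rewrite ler_peMl// (le_trans m0).
    have e1 : expR ((0 + 1) * (0 + 2) * m / 2) <= expR (y / 2).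
      by rewrite ler_expR /y; lra.
    have e2 : (s + 1) * (s + 2) * m / 2 = y / 2 by rewrite /s /y; field.
    rewrite e2 in B2.
    have B1' := le_trans B1 (ler_wpM2l (_ : 0 <= m * (1 + (0 + 2^-1) ^+ 2 * m)) e1).
    have {}B1' := B1' ltac:(by rewrite mulr_ge0// addr_ge0// mulr_ge0// sqr_ge0).
    rewrite /r; apply: le_trans (lerD B1' B2) _.
    rewrite -mulrDl ler_wpM2r ?expR_ge0// -mulrDr ler_wpM2l//.
    by rewrite /y /s; lra.
  have : mean r <= m * (2 + y) * expR (y / 2).
    rewrite /mean mulrC ler_pdivrMr// mulr_natr.
    by apply: le_trans (ler_sum _ (fun i _ => rE i)) _; rewrite sumr_const card_ord.
  move=> /(ler_wpM2l c0) /le_trans; apply.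
  by apply: eqW; rewrite /c /y; move: (expR _) => e; field.
- move=> z /=.
  have x0 i : 0 < gauss_tilt (a i) z by exact: gauss_tilt_gt0.
  have x'0 i : 0 < gauss_tilt (a' i) z by exact: gauss_tilt_gt0.
  have := @mean_powR_bound R n _ _ k b b1 x0 x'0.
  move=> /(_ (fun j jk => congr1 (fun w => gauss_tilt w z) (aa' j jk))).
  move=> /le_trans; apply.
  rewrite lerD2l -/c -/(u z) -/(v z) -/s ler_wpM2l//.
  apply: eqW; congr (mean _); apply/funext => i.
  have u0 := gauss_tilt_gt0 (a k) z; have v0 := gauss_tilt_gt0 (a' k) z.
  have uv0 : u z / v z != 0 by rewrite gt_eqF// divr_gt0.
  rewrite /S /T !powRB ?uv0 ?implybT// powRr0 powRr1 ?divr_ge0 ?ltW//.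
  have -> : (u z / v z) `^ 2 = (u z / v z) ^+ 2 by rewrite powR_mulrn// divr_ge0// ltW.
  move: {uv0} u0 v0 (x'0 i) ((u z / v z) `^ b); rewrite -/(u z) -/(v z).
  by move: (u z) (v z) (gauss_tilt _ z) => U V W U0 V0 W0 Q; field; rewrite !gt_eqF.
Qed.

Lemma gauss_mixture_step (R : realType) (n p : nat)
    (a a' : 'I_n.+1 -> 'I_p -> R) (k : 'I_n.+1) (b m c lam : R)
    (F G : p.-tuple (measurableTypeR R) -> \bar R) :
  1 <= b -> (forall j, j != k -> a j = a' j) ->
  (forall i, \sum_j a i j ^+ 2 <= m / 4) ->
  (forall i, \sum_j a' i j ^+ 2 <= m / 4) ->
  measurable_fun setT F -> measurable_fun setT G ->
  (forall z, 0 <= F z)%E -> (forall z, 0 <= G z)%E ->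
  0 <= c -> 0 < lam ->
  (forall z x, 0 < x -> (F z <= x%:E * G z + (c * (x `^ b)^-1)%:E)%E) ->
  (\int[iid (normal_prob 0 1) p]_z
      (F z * (mean (fun i => gauss_tilt (a i) z))%:E) <=
   lam%:E * \int[iid (normal_prob 0 1) p]_z
      (G z * (mean (fun i => gauss_tilt (a' i) z))%:E)
   + (c * step_growth n b m * (lam `^ b)^-1)%:E)%E.
Proof.
move=> b1 aa' am a'm mF mG F0 G0 c0 lam0 FG.
have [h [r [[hi hr] rB hb]]] := gauss_mixture_moment b1 aa' am a'm.
set P := iid _ _ in hi hr *.
pose q z := mean (fun i => gauss_tilt (a i) z).
pose q' z := mean (fun i => gauss_tilt (a' i) z).
have mq (w : 'I_n.+1 -> 'I_p -> R) : measurable_fun setT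
    (fun z => (mean (fun i => gauss_tilt (w i) z))%:E).
  apply/measurable_EFinP; apply: measurable_funM => //.
  by apply: measurable_sum => i; exact: measurable_gauss_tilt.
have q0 z : 0 < q z by apply: mean_gt0 => i; exact: gauss_tilt_gt0.
have q'0 z : 0 < q' z by apply: mean_gt0 => i; exact: gauss_tilt_gt0.
have {}hb z : q z * (q z / q' z) `^ b <= h z by exact: hb.
have h0 z : 0 <= h z.
  by apply: le_trans (hb z); rewrite mulr_ge0 ?powR_ge0// ltW.
pose C := c * (lam `^ b)^-1.
have C0 : 0 <= C by rewrite mulr_ge0// invr_ge0 powR_ge0.
have Fq0 z : (0 <= F z * (q z)%:E)%E by rewrite mule_ge0// lee_fin ltW.
have Gq0 z : (0 <= G z * (q' z)%:E)%E by rewrite mule_ge0// lee_fin ltW.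
have mGq : measurable_fun setT (fun z => G z * (q' z)%:E)%E.
  by apply: emeasurable_funM => //; exact: mq.
have mh : measurable_fun setT (EFin \o h) by exact: measurable_int hi.
have Fle z : (F z * (q z)%:E <= lam%:E * (G z * (q' z)%:E) + C%:E * (h z)%:E)%E.
  (* The hypothesis is used at this [z]-dependent [x]: after multiplication by [q], the first term
     becomes [lam G q'] and the second [c lam ^ (- b) q (q / q') ^ b], which [h] dominates. *)
  have x0 : 0 < lam * q' z / q z by rewrite divr_gt0// mulr_gt0.
  apply: le_trans (lee_wpmul2r _ (FG z _ x0)) _; first by rewrite lee_fin ltW.
  rewrite ge0_muleDl; last 2 first.
  - by rewrite mule_ge0// lee_fin ltW.
  - by rewrite lee_fin mulr_ge0// invr_ge0 powR_ge0.
  apply: leeD.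
    rewrite (muleC _ (G z)) -!muleA (muleCA _ (G z)) -!EFinM.
    by rewrite divfK// gt_eqF.
  rewrite -!EFinM lee_fin /C; move: (hb z) (q0 z) (q'0 z) {x0}.
  move: (q z) (q' z) (h z) => Q Q' H QH Q0 Q'0.
  rewrite -!mulrA; apply: ler_wpM2l => //.
  rewrite powRM ?divr_ge0 ?(ltW Q0) ?(ltW Q'0) ?(ltW lam0)// invfM.
  rewrite -!mulrA; apply: ler_wpM2l; first by rewrite invr_ge0 powR_ge0.
  by rewrite -inv_powR ?divr_ge0 ?(ltW Q0) ?(ltW Q'0)// invf_div mulrC.
apply: (@le_trans _ _ (\int[P]_z (lam%:E * (G z * (q' z)%:E) + C%:E * (h z)%:E))%E).
  apply: ge0_le_integral => //.
  - exact: emeasurable_funM.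
  - by apply: emeasurable_funD; apply: emeasurable_funM.
rewrite ge0_integralD//; last 4 first.
- by move=> z _; rewrite mule_ge0// lee_fin ltW.
- exact: emeasurable_funM.
- by move=> z _; rewrite mule_ge0// lee_fin.
- exact: emeasurable_funM.
rewrite ge0_integralZl//; last by rewrite lee_fin ltW.
rewrite ge0_integralZl//; last by move=> z _; rewrite lee_fin.
rewrite hr -EFinM leeD2l// lee_fin /C mulrAC ler_wpM2r ?invr_ge0 ?powR_ge0//.
exact: ler_wpM2l.
Qed.

(** * Measurability and projection in row vectors *)

Section row_vector_measurability.
Context {R : realType} {p : nat}.

Lemma open_rV_rat_boxes (U : set 'rV[R]_p) : open U ->
  U = \bigcup_(ab in [set ab : 'rV[rat]_p * 'rV[rat]_p |
        [set v : 'rV[R]_p | forall j, ratr (ab.1 0 j) < v 0 j < ratr (ab.2 0 j)]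
          `<=` U])
      [set v : 'rV[R]_p | forall j, ratr (ab.1 0 j) < v 0 j < ratr (ab.2 0 j)].
Proof.
move=> oU; apply/seteqP; split => [x Ux|x [ab abU xab]]; last exact: abU.
have [e /= e0 xeU] := (nbhs_ballP x U).1 (open_nbhs_nbhs (conj oU Ux)).
have lo j : exists q : rat, ratr q \in `]x 0 j - e, x 0 j[.
  by apply: rat_in_itvoo; rewrite ltrBlDr ltrDl.
have hi j : exists q : rat, ratr q \in `]x 0 j, x 0 j + e[.
  by apply: rat_in_itvoo; rewrite ltrDl.
exists (\row_j sval (cid (lo j)), \row_j sval (cid (hi j))) => /=.
  move=> v vab; apply: xeU; split => // i j; rewrite ord1.
  have := vab j; rewrite !mxE.
  case: (cid (lo j)) (cid (hi j)) => q /= + [q' /=]; rewrite !in_itv/=.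
  move=> /andP[q1 q2] /andP[q3 q4] /andP[v1 v2].
  by rewrite /ball/= ltr_distlC; apply/andP; split; lra.
move=> j; rewrite !mxE.
case: (cid (lo j)) (cid (hi j)) => q /= + [q' /=]; rewrite !in_itv/=.
by move=> /andP[q1 q2] /andP[q3 q4]; rewrite q2 q3.
Qed.

(** An open set is a countable union of rational boxes, and the preimage of a box is a finite
    intersection of coordinate conditions. *)
Lemma measurable_fun_rV d (T : measurableType d) (f : T -> 'rV[R]_p) :
  (forall j, measurable_fun setT (fun x => f x 0 j)) -> measurable_fun setT f.
Proof.
move=> mf; apply: (measurability (@open 'rV[R]_p)) => //.
move=> _ [U oU <-]; rewrite setTI (open_rV_rat_boxes oU) preimage_bigcup.
rewrite bigcup_mkcond; apply: countable_bigcupT_measurable => // ab.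
case: ifPn => _ //; rewrite [X in measurable X](_ : _ = \big[setI/setT]_(j < p)
   ((fun x => f x 0 j) @^-1` `]ratr (ab.1 0 j), ratr (ab.2 0 j)[)).
  by apply: bigsetI_measurable => j _; rewrite -[X in measurable X]setTI; exact: mf.
rewrite -bigcap_seq; apply/seteqP; split => x /=.
  by move=> xab j _ /=; rewrite in_itv/=.
by move=> xab j; have := xab j; rewrite /= in_itv/=; apply; rewrite mem_index_enum.
Qed.

Lemma open_measurable_rV (U : set 'rV[R]_p) : open U -> measurable U.
Proof. exact: sub_sigma_algebra. Qed.

Lemma continuous_rV_measurable_fun (f : 'rV[R]_p -> R) :
  continuous f -> measurable_fun setT f.
Proof.
move=> /continuousP cf; apply: (measurability _ (RGenOpens.measurableE R)).
move=> _ [_ [a [b ->] <-]]; rewrite setTI; apply: open_measurable_rV.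
exact/cf/interval_open.
Qed.

Lemma measurable_rV_coord (j : 'I_p) :
  measurable_fun setT (fun v : 'rV[R]_p => v 0 j).
Proof. by apply: continuous_rV_measurable_fun; exact: coord_continuous. Qed.

Lemma measurable_closed_rV (C : set 'rV[R]_p) : closed C -> measurable C.
Proof.
by move=> /closed_openC /open_measurable_rV /measurableC; rewrite setCK.
Qed.

End row_vector_measurability.

(** * Euclidean geometry: projection onto a convex set and length of gradients *)

Section euclidean_geometry.
Context {R : realType} {p : nat}.
Implicit Types (u v w x y z g : 'rV[R]_p) (C : set 'rV[R]_p) (t : R).

Lemma dotpC u v : dotp u v = dotp v u.
Proof. by apply: eq_bigr => i _; rewrite mulrC. Qed.

Lemma dotpDl u v w : dotp (u + v) w = dotp u w + dotp v w.
Proof. by rewrite -big_split; apply: eq_bigr => i _; rewrite mxE mulrDl. Qed.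

Lemma dotpZl t u v : dotp (t *: u) v = t * dotp u v.
Proof. by rewrite mulr_sumr; apply: eq_bigr => i _; rewrite mxE mulrA. Qed.

Lemma dotpDr u v w : dotp u (v + w) = dotp u v + dotp u w.
Proof. by rewrite dotpC dotpDl !(dotpC u). Qed.

Lemma dotpZr t u v : dotp u (t *: v) = t * dotp u v.
Proof. by rewrite dotpC dotpZl dotpC. Qed.

Lemma dotpNl u v : dotp (- u) v = - dotp u v.
Proof. by rewrite -scaleN1r dotpZl mulN1r. Qed.

Lemma dotpNr u v : dotp u (- v) = - dotp u v.
Proof. by rewrite dotpC dotpNl dotpC. Qed.

Lemma dotp_ge0 u : 0 <= dotp u u.
Proof. by apply: sumr_ge0 => i _; rewrite -expr2 sqr_ge0. Qed.

Lemma l2norm_ge0 u : 0 <= l2norm u.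
Proof. exact: sqrtr_ge0. Qed.

Lemma l2norm_sqr u : l2norm u ^+ 2 = dotp u u.
Proof. by rewrite sqr_sqrtr// dotp_ge0. Qed.

Lemma l2normZ t u : l2norm (t *: u) = `|t| * l2norm u.
Proof.
by rewrite /l2norm dotpZl dotpZr mulrA -expr2 sqrtrM ?sqr_ge0// sqrtr_sqr.
Qed.

Lemma l2norm_le u v : (l2norm u <= l2norm v) = (dotp u u <= dotp v v).
Proof. by rewrite ler_sqrt ?dotp_ge0. Qed.

Lemma coord_sqr_le_dotp u j : u 0 j ^+ 2 <= dotp u u.
Proof.
rewrite /dotp (bigD1 j)//= -expr2 lerDl.
by apply: sumr_ge0 => i _; rewrite -expr2 sqr_ge0.
Qed.

Lemma dotp_le_mx_norm u : dotp u u <= p%:R * `|u| ^+ 2.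
Proof.
rewrite -[X in X%:R]card_ord mulr_natl -sumr_const; apply: ler_sum => i _.
rewrite -expr2 -(real_normK (num_real (u 0 i))) ler_sqr ?nnegrE//.
rewrite [leRHS]/Num.norm /= mx_normrE.
by apply/bigmax_geP; right; exists (0, i).
Qed.

Lemma convex_setP C : convex_set C ->
  forall x y t, C x -> C y -> 0 <= t <= 1 -> C (x + t *: (y - x)).
Proof.
move=> cC x y t Cx Cy /andP[t0 t1].
pose s : {i01 R} := Itv01 t0 t1.
have := cC y x s; rewrite !inE => /(_ Cy Cx).
have -> : x + t *: (y - x) = t *: y + (1 - t) *: x.
  by rewrite scalerBr scalerBl scale1r addrCA addrA addrAC.
by [].
Qed.

Lemma continuous_dotp_sub x : continuous (fun z => dotp (x - z) (x - z)).
Proof.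
have c (i : 'I_p) : continuous (fun z : 'rV[R]_p => (x - z) 0 i * (x - z) 0 i).
  under eq_fun do rewrite !mxE.
  move=> z; apply: (cvg_comp (fun y : 'rV[R]_p => y 0 i)
    (fun r => (x 0 i - r) * (x 0 i - r))); first exact: coord_continuous.
  by apply: cvgM; (apply: (@cvgB _ R^o); [exact: cvg_cst|exact: cvg_id]).
have ac : continuous (fun xy : R * R => xy.1 + xy.2) by exact: add_continuous.
exact: (continuous_big ac (fun i _ => c i)).
Qed.

(** [get] returns a default value when no minimizer exists; compactness of [C] provides one. *)
Lemma l2proj_spec C x : closed C -> bounded_set C -> C !=set0 ->
  C (l2proj C x) /\ forall z, C z ->
    dotp (x - l2proj C x) (x - l2proj C x) <= dotp (x - z) (x - z).
Proof.
move=> clC bC C0.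
have [|c cC cmin] := @EVT_min_rV R p (fun z => dotp (x - z) (x - z)) C C0
    (bounded_closed_compact bC clC).
  by apply: continuous_subspaceT; exact: continuous_dotp_sub.
have : exists y, C y /\ forall z, C z -> l2norm (x - y) <= l2norm (x - z).
  exists c; split; first exact: set_mem.
  by move=> z Cz; rewrite l2norm_le; apply: cmin; rewrite inE.
move=> /getPex[] Cy ymin; split => // z Cz.
by rewrite -l2norm_le; exact: ymin.
Qed.

Lemma l2proj_variational C x z : closed C -> bounded_set C -> convex_set C ->
  C z -> dotp (x - l2proj C x) (z - l2proj C x) <= 0.
Proof.
move=> clC bC cC Cz; have [|CP Pmin] := l2proj_spec x clC bC; first by exists z.
set P := l2proj C x in CP Pmin *.
have H t : 0 <= t <= 1 ->
    0 <= t * (t * dotp (z - P) (z - P) - 2 * dotp (x - P) (z - P)).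
  move=> t01; have := Pmin _ (convex_setP cC CP Cz t01).
  have -> : x - (P + t *: (z - P)) = (x - P) + (- t) *: (z - P).
    by rewrite opprD addrA scaleNr.
  move: (x - P) (z - P) => a b.
  rewrite !(dotpDl, dotpDr, dotpZl, dotpZr) (dotpC b a); lra.
set a := dotp (x - P) (z - P) in H *; set b := dotp (z - P) (z - P) in H.
have b0 : 0 <= b := dotp_ge0 _.
rewrite leNgt; apply/negP => a0.
(* If [a > 0], moving from [P] towards [z] by [t = a / (a + b)] brings the point strictly closer to
   [x], because [t b <= a < 2 a]. *)
have t0 : 0 < a / (a + b) by rewrite divr_gt0// ltr_wpDr.
have t1 : a / (a + b) <= 1 by rewrite ler_pdivrMr ?mul1r ?lerDl// ltr_wpDr.
have := H (a / (a + b)); rewrite (ltW t0) t1 => /(_ isT).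
rewrite pmulr_rge0// subr_ge0 leNgt => /negP; apply.
have : a / (a + b) * b <= a.
  by rewrite mulrAC ler_pdivrMr ?ltr_wpDr// ler_pM2l// lerDr ltW.
lra.
Qed.

(** With [d = P - Q] and [e = x - y], the two variational inequalities add up to [|d|^2 <= <d, e>];
    expanding [|e - d|^2 >= 0] then gives [|d|^2 <= |e|^2]. *)
Lemma l2proj_nonexpansive C x y : closed C -> bounded_set C -> convex_set C ->
  C !=set0 ->
  dotp (l2proj C x - l2proj C y) (l2proj C x - l2proj C y) <= dotp (x - y) (x - y).
Proof.
move=> clC bC cC C0.
have [CP _] := l2proj_spec x clC bC C0; have [CQ _] := l2proj_spec y clC bC C0.
have := l2proj_variational x clC bC cC CQ.
have := l2proj_variational y clC bC cC CP.
move: (l2proj C x) (l2proj C y) => P Q.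
rewrite -[in X in X -> _](opprB Q P) dotpNr oppr_le0 => H2 H1.
have : 0 <= dotp ((x - y) - (P - Q)) ((x - y) - (P - Q)) by exact: dotp_ge0.
have : dotp ((x - y) - (P - Q)) (Q - P) <= 0.
  have -> : x - y - (P - Q) = (x - P) - (y - Q).
    by rewrite opprD opprK addrACA opprD opprK.
  by rewrite dotpDl dotpNl; lra.
rewrite -(opprB P Q).
move: (P - Q) (x - y) => d e.
rewrite !(dotpDl, dotpDr, dotpNl, dotpNr) (dotpC d e); lra.
Qed.

Lemma measurable_l2proj C : closed C -> bounded_set C -> convex_set C ->
  C !=set0 -> measurable_fun setT (l2proj C).
Proof.
move=> clC bC cC C0; apply: measurable_fun_rV => j.
apply: continuous_rV_measurable_fun => x s /=.
move=> /(nbhs_ballP (l2proj C x 0 j)) [e /= e0 es].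
have p0 : 0 < p.+1%:R :> R by [].
(* Balls are those of the sup norm, which costs a factor [p] on squares, and [p < (p + 1) ^ 2];
   [p.+1] also allows [p = 0]. *)
apply/nbhs_ballP; exists (e / p.+1%:R) => /=; first by rewrite divr_gt0.
move=> y; rewrite mx_norm_ball /ball_/= => xy; apply: es; rewrite /ball/=.
have le_e : `|l2proj C x 0 j - l2proj C y 0 j| ^+ 2 <= p%:R * `|x - y| ^+ 2.
  rewrite real_normK ?num_real//.
  apply: le_trans (dotp_le_mx_norm _).
  apply: le_trans (l2proj_nonexpansive x y clC bC cC C0).
  by have := coord_sqr_le_dotp (l2proj C x - l2proj C y) j; rewrite !mxE.
rewrite -ltr_sqr ?nnegrE ?(ltW e0)//; apply: le_lt_trans le_e _.
have /(ler_wpM2l (ler0n R p)) : `|x - y| ^+ 2 <= (e / p.+1%:R) ^+ 2.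
  by rewrite ler_sqr ?nnegrE ?divr_ge0 ?(ltW e0) ?(ltW xy).
move=> /le_lt_trans; apply.
rewrite expr_div_n mulrCA gtr_pMr ?exprn_gt0// ltr_pdivrMr ?exprn_gt0// mul1r.
by rewrite -natrX ltr_nat -mulnn mulnS addSn ltnS leq_addr.
Qed.

Lemma interior_segment C x g : C^° x ->
  exists2 e : R, 0 < e & forall h, `|h| < e -> C (h *: g + x).
Proof.
move=> /nbhs_ballP[e /= e0 eC]; have g0 : 0 < `|g| + 1 by rewrite ltr_wpDl.
exists (e / (`|g| + 1)); first by rewrite divr_gt0.
move=> h he; apply: eC; rewrite mx_norm_ball /ball_/= opprD addrCA subrr addr0 normrN.
rewrite mx_normZ; apply: (@le_lt_trans _ _ (`|h| * (`|g| + 1))).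
  by rewrite ler_wpM2l// lerDl.
by rewrite -ltr_pdivlMr.
Qed.

(** At an interior point, a small move [h] along [g] changes [f] by at most [h L |g|], whereas the
    derivative along [g], or the subgradient inequality, gives a rate of at least [|g|^2]. Elsewhere
    the bound is part of the choice. *)
Lemma gradient_choice_norm_le C (L : R) (f : 'rV[R]_p -> R) x g :
  0 <= L -> l2_lipschitz_on C L f -> C x -> is_gradient_choice C L f x g ->
  l2norm g <= L.
Proof.
move=> L0 lipf Cx [gdiff gsub gbd].
have [intx|] := pselect (C^° x); last exact: gbd.
suff : l2norm g ^+ 2 <= L * l2norm g.
  have [->//|g0] := eqVneq (l2norm g) 0.
  by rewrite expr2 ler_pM2r// lt_neqAle eq_sym g0 l2norm_ge0.
rewrite l2norm_sqr.
have [e e0 eC] := interior_segment g intx.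
have lip h : `|h| < e -> `|f (h *: g + x) - f x| <= `|h| * (L * l2norm g).
  by move=> /eC Cy; rewrite mulrCA -l2normZ -[in leRHS](addrK x (h *: g)); exact: lipf.
have [df|ndf] := pselect (differentiable f x).
  rewrite -(gdiff intx df g) -deriveE//; apply: limr_le.
    exact: diff_derivable.
  apply/nbhs_ballP; exists e => //= h; rewrite /ball/= sub0r normrN => he h0.
  apply: le_trans (ler_norm _) _.
  rewrite /GRing.scale/= normrM normfV ler_pdivrMl ?normr_gt0//.
  by rewrite [h *: g + x]/(_ + _); exact: lip.
have e2 : 0 < e / 2 by rewrite divr_gt0.
have e2e : `|e / 2| < e by rewrite gtr0_norm// ltr_pdivrMr// mulr_natr mulr2n ltrDr.
have := gsub (fun c => ndf c.2) _ (eC _ e2e).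
rewrite addrK dotpZr => H.
have := ler_normlW (lip _ e2e).
rewrite gtr0_norm// lerBlDr => /(le_trans H); rewrite [leRHS]addrC lerD2l.
by rewrite ler_pM2l.
Qed.
End euclidean_geometry.

(** * Induction over the steps *)

Lemma measurable_fun_ord_param d d' (T : measurableType d) (T' : measurableType d')
    (n : nat) (e : T -> 'I_n.+1) (h : 'I_n.+1 -> T -> T') :
  measurable_fun setT e -> (forall i, measurable_fun setT (h i)) ->
  measurable_fun setT (fun x => h (e x) x).
Proof.
move=> me mh _ A mA; rewrite setTI.
have -> : (fun x => h (e x) x) @^-1` A =
    \bigcup_(i in [set: 'I_n.+1]) (e @^-1` [set i] `&` (h i @^-1` A)).
  apply/seteqP; split => [x Ax|x [i _ [/= -> //]]].
  by exists (e x).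
apply: countable_bigcupT_measurable => // i; apply: measurableI.
  by rewrite -[X in measurable X]setTI; exact: me.
by rewrite -[X in measurable X]setTI; exact: mh.
Qed.

Lemma ge0_integral_uniform_ord (R : realType) (n : nat) (f : 'I_n.+1 -> \bar R) :
  (forall i, 0 <= f i)%E ->
  (\int[@uniform_ord R n]_i f i = n.+1%:R^-1%:E * \sum_(i < n.+1) f i)%E.
Proof.
move=> f0; rewrite ge0_integral_mscale//.
rewrite ge0_integral_measure_sum//.
congr (_ * _)%E; apply: eq_bigr => i _.
by rewrite integral_dirac// diracT mul1e inord_val.
Qed.

Section hitting_probability.
Context {R : realType} {X : Type} {p n : nat}.
Variables (C : set 'rV[R]_p) (grad : X -> 'rV[R]_p -> 'rV[R]_p).
Variables (L eps delta : R) (eta : nat -> R).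
Hypotheses (clC : closed C) (bC : bounded_set C) (cC : convex_set C).
Hypothesis (C0 : C !=set0).
Hypothesis mgrad : forall d, measurable_fun setT (grad d).
Variable D : n.+1.-tuple X.

Let noise : probability (p.-tuple (measurableTypeR R)) R := iid (@normal_prob R 0 1) p.
Let seed : probability ('I_n.+1 * p.-tuple (measurableTypeR R))%type R :=
  (@uniform_ord R n \x noise)%E.
Let step t := noise_gd_step C grad L eps delta eta D t.
Let sigma := Num.sqrt (noise_sigma2 (n := n) L eps delta).

(** For two neighbouring data sets these are the [f] and [g] of the overview; [t] is the index
    passed to [eta] and [k] the number of steps left. *)
Definition hit (S : set 'rV[R]_p) (t k : nat) (theta : 'rV[R]_p) : \bar R :=
  iid seed k [set ws : k.-tuple _ |
    S (noise_gd_from C grad L eps delta eta D t theta ws)].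

Lemma hit0 S t theta : hit S t 0 theta = (\1_S theta)%:E.
Proof. by rewrite /hit/= /dirac/= !indicE; congr (_%:R)%:E; congr nat_of_bool. Qed.

(** Conditioning on the first seed: [iid] is the image of a product of the first draw with the
    remaining ones, so this is the definition of the product measure. *)
Lemma hitS S t k theta :
  hit S t k.+1 theta = (\int[seed]_w hit S t.+1 k (step t theta w))%E.
Proof.
transitivity (\int[seed]_w (iid seed k \o xsection (@cons_pair _ _ k @^-1`
    [set ws : k.+1.-tuple _ |
      S (noise_gd_from C grad L eps delta eta D t theta ws)])) w)%E.
  by [].
apply: eq_integral => w _ /=; congr (iid _ _ _).
by apply/seteqP; split => ws; rewrite /xsection/= inE.
Qed.

Lemma hit_ge0 S t k theta : (0 <= hit S t k theta)%E.
Proof. exact: measure_ge0. Qed.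

Lemma measurable_step t :
  measurable_fun setT (fun tw : 'rV[R]_p * ('I_n.+1 * p.-tuple (measurableTypeR R)) =>
    step t tw.1 tw.2).
Proof.
apply: measurableT_comp; first exact: measurable_l2proj.
apply: measurable_fun_rV => j.
pose T := ('rV[R]_p * ('I_n.+1 * p.-tuple (measurableTypeR R)))%type.
have m1 : measurable_fun setT (fun tw : T => tw.1 0 j).
  by apply: (measurableT_comp (measurable_rV_coord j)).
have m2 : measurable_fun setT (fun tw : T => grad (tnth D tw.2.1) tw.1 0 j).
  apply: (@measurable_fun_ord_param _ _ T R n (fun tw => tw.2.1)
    (fun i tw => grad (tnth D i) tw.1 0 j)).
    exact: (measurableT_comp measurable_fst measurable_snd).
  move=> i; apply: (measurableT_comp (measurable_rV_coord j)).
  exact: (measurableT_comp (mgrad _) measurable_fst).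
have m3 : measurable_fun setT (fun tw : T => tnth tw.2.2 j : R).
  apply: (measurableT_comp (measurable_tnth j)).
  exact: (measurableT_comp measurable_snd measurable_snd).
rewrite [X in measurable_fun _ X](_ : _ = fun tw : T =>
  tw.1 0 j - eta t * (n.+1%:R * grad (tnth D tw.2.1) tw.1 0 j + sigma * tnth tw.2.2 j)).
  apply: measurable_funB => //; apply: measurable_funM => //.
  by apply: measurable_funD; apply: measurable_funM.
by apply/funext => tw; rewrite !mxE.
Qed.

Lemma measurable_hit S t k : measurable S -> measurable_fun setT (hit S t k).
Proof.
move=> mS; elim: k t => [|k IH] t.
  rewrite (funext (hit0 S t)).
  by apply/measurable_EFinP; exact: measurable_indic.
rewrite (funext (hitS S t k)).
apply: (measurable_fun_fubini_tonelli_F (m2 := seed)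
  (fun tw => hit S t.+1 k (step t tw.1 tw.2))).
  by apply: (measurableT_comp (IH _)); exact: measurable_step.
by move=> tw; exact: hit_ge0.
Qed.

Lemma measurable_hit_noise S t k theta : measurable S ->
  measurable_fun setT (fun z : p.-tuple (measurableTypeR R) =>
    hit S t.+1 k (l2proj C (theta - eta t *: (sigma *: \row_j tnth z j)))).
Proof.
move=> mS; apply: (measurableT_comp (measurable_hit _ _ mS)).
apply: measurableT_comp; first exact: measurable_l2proj.
apply: measurable_fun_rV => j.
under eq_fun do rewrite !mxE.
apply: measurable_funB => //; apply: measurable_funM => //.
by apply: measurable_funM => //; exact: measurable_tnth.
Qed.

(* [a i] is the scaled gradient in units of [sigma]; the hypothesis also covers
   [sigma = 0], which forces the gradients to vanish. *)
Lemma hitS_mixture S t k theta (a : 'I_n.+1 -> 'I_p -> R) : measurable S ->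
  (forall i j, n.+1%:R * grad (tnth D i) theta 0 j = sigma * a i j) ->
  (hit S t k.+1 theta =
   \int[noise]_z (hit S t.+1 k (l2proj C (theta - eta t *: (sigma *: \row_j tnth z j)))
     * (mean (fun i => gauss_tilt (a i) z))%:E))%E.
Proof.
move=> mS aE; rewrite hitS.
have mstep : measurable_fun setT (fun w => hit S t.+1 k (step t theta w)).
  apply: (measurableT_comp (measurable_hit _ _ mS)).
  exact: (measurableT_comp (measurable_step t) (measurable_pair1 theta)).
rewrite fubini_tonelli1//.
rewrite ge0_integral_uniform_ord; last first.
  by move=> i; apply: integral_ge0 => z _; exact: hit_ge0.
pose Phi z := hit S t.+1 k (l2proj C (theta - eta t *: (sigma *: \row_j tnth z j))).
have mPhi : measurable_fun setT Phi by exact: measurable_hit_noise.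
have Phi0 z : (0 <= Phi z)%E by exact: hit_ge0.
have mtilt i : measurable_fun setT (fun z => Phi z * (gauss_tilt (a i) z)%:E)%E.
  apply: emeasurable_funM => //; apply/measurable_EFinP.
  exact: measurable_gauss_tilt.
have tilt0 i z : (0 <= Phi z * (gauss_tilt (a i) z)%:E)%E.
  by rewrite mule_ge0// lee_fin ltW// gauss_tilt_gt0.
(* Given the index [i], the step is the pure-noise step at shifted noise, and Cameron-Martin turns
   the shift into a density. *)
have E i : (\int[noise]_z hit S t.+1 k (step t theta (i, z)) =
    \int[noise]_z (Phi z * (gauss_tilt (a i) z)%:E))%E.
  rewrite -(ge0_integral_gauss_shift (a i) mPhi Phi0).
  apply: eq_integral => z _; rewrite /Phi /step /noise_gd_step.
  congr (hit _ _ _ (l2proj _ (_ - _ *: _))); apply/rowP => j.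
  by rewrite !mxE/= tnth_mktuple aE mulrDr addrC.
under eq_bigr do
  rewrite -[fubini_F _ _ _]/(\int[noise]_z hit S t.+1 k (step t theta (_, z)))%E E.
rewrite -ge0_integral_sum//.
rewrite -ge0_integralZl//; last 2 first.
- exact: emeasurable_sum.
- by move=> z _; apply: sume_ge0.
apply: eq_integral => z _; rewrite -ge0_sume_distrr.
  by rewrite muleCA sumEFin -EFinM.
by move=> i _; rewrite lee_fin ltW// gauss_tilt_gt0.
Qed.
End hitting_probability.

(** Every step ends with a projection, so the gradient is only evaluated on [C]. This allows
    replacing it by an extension measurable on the whole space. *)
Lemma noise_gd_from_congr (R : realType) (X : Type) (p n : nat) (C : set 'rV[R]_p)
    (grad grad' : X -> 'rV[R]_p -> 'rV[R]_p) (L eps delta : R) (eta : nat -> R)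
    (D : n.+1.-tuple X) t theta ws :
  closed C -> bounded_set C -> (forall d x, C x -> grad d x = grad' d x) ->
  C theta ->
  noise_gd_from C grad L eps delta eta D t theta ws =
  noise_gd_from C grad' L eps delta eta D t theta ws.
Proof.
move=> clC bC gg'; elim: ws t theta => [t theta _|w ws IH t theta Ctheta].
  exact: erefl.
have stepE : noise_gd_step C grad L eps delta eta D t theta w =
    noise_gd_step C grad' L eps delta eta D t theta w.
  by rewrite /noise_gd_step gg'.
have CS : C (noise_gd_step C grad' L eps delta eta D t theta w).
  have [+ _] := l2proj_spec (theta - eta t *: (n.+1%:R *: grad' (tnth D w.1) theta +
    Num.sqrt (noise_sigma2 (n := n) L eps delta) *: \row_j tnth w.2 j)) clC bC
    (ex_intro _ _ Ctheta).
  exact.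
rewrite [LHS]/= [RHS]/= stepE.
exact: IH.
Qed.

Lemma hit_congr (R : realType) (X : Type) (p n : nat) (C S : set 'rV[R]_p)
    (grad grad' : X -> 'rV[R]_p -> 'rV[R]_p) (L eps delta : R) (eta : nat -> R)
    (D : n.+1.-tuple X) t k theta :
  closed C -> bounded_set C -> (forall d x, C x -> grad d x = grad' d x) ->
  C theta ->
  hit C grad L eps delta eta D S t k theta = hit C grad' L eps delta eta D S t k theta.
Proof.
move=> clC bC gg' Ctheta; rewrite /hit.
apply: (congr1 (iid _ k)); apply/funext => ws.
exact: (congr1 S (noise_gd_from_congr L eps delta eta D t ws clC bC gg' Ctheta)).
Qed.

(** The invariant with no step left and the origin of [1 / 4]: for [x <= 1] it reduces to
    [x + 1 / (4 x) >= 1], that is [(2 x - 1) ^ 2 >= 0]. *)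
Lemma le1_add_inv_powR (R : realType) (b x : R) : 1 <= b -> 0 < x ->
  1 <= x + 4^-1 * (x `^ b)^-1.
Proof.
move=> b1 x0; have [x1|/ltW x1] := leP 1 x.
  by rewrite (le_trans x1)// lerDl mulr_ge0// invr_ge0 powR_ge0.
have : x^-1 <= (x `^ b)^-1.
  by rewrite lef_pV2 ?posrE ?powR_gt0//; apply: ge1r_powR => //; rewrite x0.
have : 0 <= x^-1 * (2 * x - 1) ^+ 2 by rewrite mulr_ge0 ?sqr_ge0// invr_ge0 ltW.
have -> : x^-1 * (2 * x - 1) ^+ 2 = 4 * x - 4 + x^-1 by field; rewrite gt_eqF.
lra.
Qed.

(** The invariant of the overview. [A] is the scaled gradient in units of the noise deviation,
    related to it by a product rather than a quotient because the deviation may be 0. *)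
Lemma hit_le (R : realType) (X : Type) (p n : nat) (C S : set 'rV[R]_p)
    (grad : X -> 'rV[R]_p -> 'rV[R]_p) (L eps delta b m : R) (eta : nat -> R)
    (A : X -> 'rV[R]_p -> 'I_p -> R) (D D' : n.+1.-tuple X) :
  closed C -> bounded_set C -> convex_set C ->
  (forall d, measurable_fun setT (grad d)) -> measurable S ->
  1 <= b -> 0 <= m ->
  (forall d theta, C theta -> forall j, n.+1%:R * grad d theta 0 j =
     Num.sqrt (noise_sigma2 (n := n) L eps delta) * A d theta j) ->
  (forall d theta, C theta -> \sum_j A d theta j ^+ 2 <= m / 4) ->
  neighbors D D' ->
  forall k t theta x, C theta -> 0 < x ->
  (hit C grad L eps delta eta D S t k theta <=
    x%:E * hit C grad L eps delta eta D' S t k theta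
    + (4^-1 * step_growth n b m ^+ k * (x `^ b)^-1)%:E)%E.
Proof.
move=> clC bC cC mgrad mS b1 m0 scale bound [i0 [_ DD']].
have g0 : 0 <= step_growth n b m.
  have y0 : 0 <= (b + 1) * b * m by rewrite !mulr_ge0//; lra.
  rewrite addr_ge0// divr_ge0 ?exprn_ge0// mulr_ge0 ?expR_ge0//.
  by rewrite mulr_ge0// addr_ge0.
elim=> [|k IH] t theta x Ctheta x0.
  rewrite !hit0 -EFinM -EFinD lee_fin expr0 mulr1 indicE.
  case: (theta \in S); rewrite ?mulr1 ?mulr0 ?add0r.
    exact: le1_add_inv_powR.
  by rewrite mulr_ge0// invr_ge0 powR_ge0.
have C0 : C !=set0 by exists theta.
have sc (E : n.+1.-tuple X) i j := scale (tnth E i) theta Ctheta j.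
rewrite (hitS_mixture eta clC bC cC C0 mgrad t k mS (sc D)).
rewrite (hitS_mixture eta clC bC cC C0 mgrad t k mS (sc D')).
rewrite exprSr mulrA.
pose Phi (E : n.+1.-tuple X) z := hit C grad L eps delta eta E S t.+1 k
  (l2proj C (theta - eta t *:
    (Num.sqrt (noise_sigma2 (n := n) L eps delta) *: \row_j tnth z j))).
have mPhi E : measurable_fun setT (Phi E).
  exact: (measurable_hit_noise L eps delta eta clC bC cC C0 mgrad E t k theta mS).
have Phi0 E z : (0 <= Phi E z)%E by exact: hit_ge0.
have c0 : 0 <= 4^-1 * step_growth n b m ^+ k by rewrite mulr_ge0// exprn_ge0.
apply: (gauss_mixture_step (k := i0) b1 _ _ _
  (mPhi D) (mPhi D') (Phi0 D) (Phi0 D') c0 x0).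
- by move=> j /DD' ->.
- by move=> i; exact: bound.
- by move=> i; exact: bound.
- move=> z y y0; apply: IH => //.
  exact: (l2proj_spec _ clC bC C0).1.
Qed.

(** * Privacy budget and choice of the parameters *)

(** Here [l] stands for [ln delta^-1]. For these [b] and [m], [y = (2 l + eps) / (4 La)], and
    [eps <= 2 l] gives [y <= l / La]. The number of steps is at most [n.+1 ^ 2], so the power is at
    most the exponential of [y (2 + y) exp (y / 2)]. *)
Lemma step_growth_expn_le (R : realType) (n : nat) (eps l : R) :
  (0 < n)%N -> 0 < eps -> 0 < l ->
  let b := 2 * l / eps in
  let m := eps ^+ 2 / (8 * (ln n.+1%:R + l) * l) in
  eps <= 2 * l ->
  step_growth n b m ^+ (n.+1 ^ 2).-1 <= 4 * expR l.
Proof.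
move=> n0 e0 l0 b m eps_le; set La := ln n.+1%:R + l.
have La2 : l + ln 2 <= La.
  by rewrite /La addrC lerD2r ler_ln ?posrE// ler_nat.
have m68 := @ln2_lbound R.
have La0 : 0 < La by lra.
pose y := (b + 1) * b * m.
have yE : y = (2 * l + eps) / (4 * La).
  by rewrite /y /b /m -/La; field; rewrite !gt_eqF.
have y0 : 0 <= y by rewrite yE divr_ge0// ltW//; lra.
have yl : y <= l / La.
  have -> : l / La = (4 * l) / (4 * La) by field; rewrite gt_eqF.
  by rewrite yE ler_pM2r ?invr_gt0 ?mulr_gt0//; lra.
have c0 : 0 <= y * (2 + y) * expR (y / 2).
  by rewrite mulr_ge0 ?expR_ge0// mulr_ge0// addr_ge0.
rewrite /step_growth -/y -natrX.
apply: le_trans (expn_1Ddiv_le c0 _ (leq_pred _)) _; first by rewrite expn_gt0.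
apply: (@le_trans _ _ (expR (l + 2 * ln 2))).
  by rewrite ler_expR; exact: budget_exponent_le l0 La2 y0 yl.
rewrite expRD mulrC ler_pM2r ?expR_gt0// mulrC expRM_natr lnK ?posrE//.
by rewrite expr2 -natrM.
Qed.

Theorem theorem2p1 (R : realType) (X : Type) (p n : nat)
    (C : set 'rV[R]_p) (l : X -> 'rV[R]_p -> R)
    (grad : X -> 'rV[R]_p -> 'rV[R]_p)
    (L eps delta : R) (eta : nat -> R) (theta1 : 'rV[R]_p)
    (C_closed : closed C) (C_bounded : bounded_set C) (C_convex : convex_set C)
    (L_ge0 : 0 <= L)
    (l_convex : forall d, convex_function C (l d))
    (l_lipschitz : forall d, l2_lipschitz_on C L (l d))
    (grad_l : forall d x, C x -> is_gradient_choice C L (l d) x (grad d x))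
    (grad_measurable : forall d, measurable_fun C (grad d))
    (eps_gt0 : 0 < eps) (delta_gt0 : 0 < delta) (delta_lt1 : delta < 1)
    (eps_le : eps <= 2 * ln delta^-1)
    (theta1_C : C theta1) :
  differentially_private eps delta
    (noise_gd (n := n) C grad L eps delta eta theta1).

Proof.
(* [grad d] is only known to be measurable on [C], which the iterates never leave. *)
pose G d x : 'rV[R]_p := if x \in C then grad d x else 0.
have GE d x : C x -> grad d x = G d x by move=> Cx; rewrite /G mem_set.
have mG d : measurable_fun setT (G d).
  apply: measurable_fun_if => //.
  - apply: (measurable_fun_bool true); rewrite setTI preimage_mem_true.
    exact: measurable_closed_rV.
  - by rewrite setTI preimage_mem_true; exact: grad_measurable.
have clC := C_closed; have C0 : C !=set0 by exists theta1.
move=> D D' nDD' S mS.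
have noise_gdE (E : n.+1.-tuple X) : noise_gd C grad L eps delta eta theta1 E S =
    hit C G L eps delta eta E S 1 (n.+1 ^ 2).-1 theta1.
  exact: (hit_congr S L eps delta eta E 1 _ C_closed C_bounded GE theta1_C).
rewrite !noise_gdE.
(* Data sets of size one leave no step at all, so the output is [theta1] for any data. *)
have [n0|n0] := posnP n.
  rewrite n0 in D D' noise_gdE nDD' *.
  rewrite !hit0 -EFinM -EFinD lee_fin indicE.
  case: (theta1 \in S); last by rewrite mulr0 add0r ltW.
  have := expR_ge1Dx eps; rewrite /= !mulr1n mulr1; lra.
pose ld := ln delta^-1; pose La := ln n.+1%:R + ld.
have ld0 : 0 < ld by rewrite ln_gt0// invf_gt1.
have La0 : 0 < La by rewrite ltr_wpDl// ln_ge0// ler1n.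
(* For [L > 0], [m / 4] is [L ^ 2 n.+1 ^ 2] divided by the noise variance; written without [L], it
   also makes sense for [L = 0]. *)
pose b := 2 * ld / eps; pose m := eps ^+ 2 / (8 * La * ld).
have b1 : 1 <= b by rewrite ler_pdivlMr ?mul1r.
have m0 : 0 <= m by rewrite divr_ge0 ?exprn_ge0 ?mulr_ge0// ltW.
pose s2 : R := noise_sigma2 (n := n) L eps delta.
have s2E : s2 = L ^+ 2 * n.+1%:R ^+ 2 * (m / 4)^-1.
  rewrite /s2 /noise_sigma2 ln_div ?posrE// -(lnV _) ?posrE//.
  by rewrite -/ld -/La /m; field; rewrite !gt_eqF.
have m1 : 0 < m by rewrite divr_gt0 ?exprn_gt0// !mulr_gt0.
have m4 : 0 < m / 4 by rewrite divr_gt0.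
have s20 : 0 <= s2.
  by rewrite s2E !mulr_ge0 ?exprn_ge0// invr_ge0 divr_ge0.
have sig2 : Num.sqrt s2 ^+ 2 = s2 by rewrite sqr_sqrtr.
have gL d theta : C theta -> l2norm (G d theta) <= L.
  move=> Cth; rewrite -GE//.
  exact: gradient_choice_norm_le L_ge0 (l_lipschitz d) Cth (grad_l d _ Cth).
pose A d theta (j : 'I_p) := n.+1%:R * G d theta 0 j / Num.sqrt s2.
have sqG d theta : \sum_j (G d theta 0 j) ^+ 2 = l2norm (G d theta) ^+ 2.
  by rewrite l2norm_sqr; apply: eq_bigr => j _; rewrite expr2.
have scale d theta : C theta -> forall j, n.+1%:R * G d theta 0 j =
    Num.sqrt s2 * A d theta j.
  (* A vanishing deviation forces [L = 0], and then all gradients on [C] are 0. *)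
  move=> Cth j; have [s0|s0] := eqVneq (Num.sqrt s2) 0; last first.
    by rewrite /A [RHS]mulrC divfK.
  have L0 : L = 0.
    apply/eqP; move: s0 => /eqP; rewrite -sqrf_eq0 sig2 s2E !mulf_eq0 invr_eq0.
    by rewrite (gt_eqF m4) pnatr_eq0/= !orbF orbb.
  have : l2norm (G d theta) ^+ 2 = 0.
    by apply/eqP; rewrite sqrf_eq0 -normr_le0 ger0_norm ?l2norm_ge0// -L0 gL.
  rewrite -sqG => /psumr_eq0P H.
  have /eqP := H (fun i _ => sqr_ge0 _) j isT; rewrite sqrf_eq0 => /eqP ->.
  by rewrite s0 mulr0 mul0r.
have bound d theta : C theta -> \sum_j A d theta j ^+ 2 <= m / 4.
  move=> Cth; have [s0|s0] := eqVneq (Num.sqrt s2) 0.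
    rewrite big1 => [|j _]; first by rewrite divr_ge0.
    by rewrite /A s0 invr0 mulr0 expr0n.
  under eq_bigr do rewrite /A exprMn exprMn exprVn.
  rewrite -mulr_suml -mulr_sumr sqG sig2.
  have s2p : 0 < s2 by rewrite -sig2 exprn_even_gt0.
  rewrite ler_pdivrMr// s2E [leRHS]mulrC divfK ?(gt_eqF m4)//.
  rewrite [leRHS]mulrC ler_wpM2l ?exprn_ge0//.
  by rewrite ler_sqr ?nnegrE ?l2norm_ge0// gL.
have := hit_le eta clC C_bounded C_convex mG mS b1 m0 scale bound nDD'
  (n.+1 ^ 2).-1 1 theta1_C (expR_gt0 eps).
move=> /le_trans; apply.
rewrite leeD2l// lee_fin.
(* The order [b] is chosen so that [x ^ (- b) = delta ^ 2] at [x = exp eps]; the additive error is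
   then at most [(1 / 4) (4 / delta) delta ^ 2 = delta]. *)
have -> : expR eps `^ b = (delta ^+ 2)^-1.
  rewrite -expRM /b mulrC divfK ?gt_eqF// mulrC expRM_natr lnK ?posrE ?invr_gt0//.
  by rewrite exprVn.
rewrite invrK.
have := step_growth_expn_le n0 eps_gt0 ld0 eps_le.
rewrite -/La -/b -/m lnK ?posrE ?invr_gt0//.
move=> /(ler_wpM2l (ltW (exprn_gt0 2 delta_gt0))) H.
rewrite -mulrA mulrC -ler_pdivlMr// invrK.
rewrite mulrC; apply: le_trans H _.
by apply: eqW; field; rewrite gt_eqF.
Qed.
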